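(* Let $m\ge 2$ be an integer, $\alpha,L>0$, and let $\mathcal{Y}=\Theta\circ\pi+\mathcal{E}$ be an observation from the order-$m$, $d$-dimensional sub-Gaussian permuted smooth tensor model, where $\Theta\in\mathcal{P}(\alpha,L)$ and $\pi\in\Pi(d,d)$ are unknown. For given $(k,\ell)$ let $$(\hat\Theta^{\mathrm{LSE}},\hat\pi^{\mathrm{LSE}})\in\operatorname*{arg\,min}_{\Theta'\in\mathscr{B}(k,\ell),\ \pi'\in\Pi(d,d)}\|\mathcal{Y}-\Theta'\circ\pi'\|_F .$$ Then, for every block number $k\le d$ and every degree $\ell\in\mathbb{N}$, $$\mathrm{MSE}(\hat\Theta^{\mathrm{LSE}}\circ\hat\pi^{\mathrm{LSE}},\ \Theta\circ\pi)\ \lesssim\ \frac{L^2}{k^{2\min(\alpha,\ell+1)}}+\frac{k^m(\ell+m)^\ell}{d^m}+\frac{\log d}{d^{m-1}}\qquad(\ast)$$ with high probability. In particular, setting $\ell^*=\min\big(\lceil\alpha-1\rceil,\,(m-2)(m+1)/2\big)$ and $k^*=c_1 d^{m/(m+2\min(\alpha,\ell^*+1))}$ (rounded up to an integer), the right-hand side of $(\ast)$ is $$\lesssim\ \begin{cases} c_2\, d^{-\frac{2m\alpha}{m+2\alpha}}, & \text{when }\alpha<m(m-1)/2,\\ c_3\, d^{-(m-1)}\log d, & \text{when }\alpha\ge m(m-1)/2,\end{cases}$$ where the constants $c_1,c_2,c_3>0$ depend on $(m,L,\alpha)$ but not on $d$.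
   Context: Notation: $[d]=\{1,\dots,d\}$; $\mathbb{N}$ is the set of non-negative integers; $\Pi(d,d)$ is the set of permutations of $[d]$; $\|\cdot\|_F$ is the Frobenius norm (square root of the sum of squared entries). For an order-$m$ $d$-dimensional tensor $\Theta\in\mathbb{R}^{d\times\cdots\times d}$ and $\pi\in\Pi(d,d)$, $(\Theta\circ\pi)(i_1,\dots,i_m)=\Theta(\pi(i_1),\dots,\pi(i_m))$. $\mathrm{MSE}(\Theta_1,\Theta_2)=d^{-m}\|\Theta_1-\Theta_2\|_F^2$. Hölder class: $f:[0,1]^m\to\mathbb{R}$ belongs to $\mathcal{F}(\alpha,L)$ if $\sum_{\kappa\in\mathbb{N}^m:|\kappa|=\lceil\alpha-1\rceil}\frac{1}{\kappa!}|\nabla_\kappa f(x)-\nabla_\kappa f(x_0)|\le L\|x-x_0\|_\infty^{\alpha-\lceil\alpha-1\rceil}$ for all $x,x_0\in[0,1]^m$, where $|\kappa|=\sum_i\kappa_i$, $\kappa!=\prod_i\kappa_i!$ and $\nabla_\kappa=\partial^{|\kappa|}/\partial x_1^{\kappa_1}\cdots\partial x_m^{\kappa_m}$. Smooth tensor class: $\mathcal{P}(\alpha,L)$ is the set of tensors $\Theta\in\mathbb{R}^{d\times\cdots\times d}$ of the form $\Theta(i_1,\dots,i_m)=f(i_1/d,\dots,i_m/d)$ for all $(i_1,\dots,i_m)\in[d]^m$, with $f\in\mathcal{F}(\alpha,L)$ (as $d$ varies, $\Theta$ is generated from $f$ in this way). Sub-Gaussian model: $\mathcal{E}$ has independent (not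 necessarily identically distributed) zero-mean sub-Gaussian entries with variance proxy bounded by $\sigma^2=1$. Block-wise polynomial tensors: let $z:[d]\to[k]$, $z(i)=\lceil ki/d\rceil$, and $\mathcal{E}_k=\{z^{-1}(j_1)\times\cdots\times z^{-1}(j_m):(j_1,\dots,j_m)\in[k]^m\}$, a partition of $[d]^m$ into $k^m$ blocks. $\mathscr{B}(k,\ell)$ is the set of tensors $\mathcal{B}\in\mathbb{R}^{d\times\cdots\times d}$ whose restriction to each block $\Delta\in\mathcal{E}_k$ coincides with a polynomial in $\omega=(i_1,\dots,i_m)$ of (total) degree at most $\ell$, with coefficients depending on $\Delta$. Asymptotic conventions ($d\to\infty$, other model quantities fixed, $k$ allowed to depend on $d$): $a_d\lesssim b_d$ means $\lim_{d\to\infty}a_d/b_d\le c$ for some constant $c>0$ not depending on $d$. An event holds with high probability if its probability tends to $1$ as $d\to\infty$. *)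

(* Defs.v *)
(* MathComp-Analysis.  [mpoly] is imported without its notations, because they
   clash with those of MathComp-Analysis. *)
From HB Require Import structures.
From mathcomp Require Import all_boot all_order all_algebra all_fingroup.
From mathcomp Require Import all_classical all_reals all_analysis.
From mathcomp Require mpoly.
Import -(notations) mpoly.

Set Implicit Arguments.
Unset Strict Implicit.
Unset Printing Implicit Defensive.

Import Order.TTheory GRing.Theory Num.Theory.
Import numFieldNormedType.Exports.

Local Open Scope classical_set_scope.
Local Open Scope ring_scope.

(* Indices are 0-based: the component [i j : 'I_d] stands for the element
   (i j).+1 of [d] = {1, ..., d}. *)
Definition tensor_index (m d : nat) : finType := {ffun 'I_m -> 'I_d}.

Definition tensor (R : realType) (m d : nat) := {ffun tensor_index m d -> R}.

Definition tensor_perm (R : realType) (m d : nat) (Theta : tensor R m d)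
    (pi : 'S_d) : tensor R m d :=
  [ffun i : tensor_index m d => Theta [ffun j => pi (i j)]].

Definition frobenius (R : realType) (m d : nat) (Theta : tensor R m d) : R :=
  Num.sqrt (\sum_i Theta i ^+ 2).

Definition MSE (R : realType) (m d : nat) (Theta1 Theta2 : tensor R m d) : R :=
  (d%:R ^+ m)^-1 * frobenius (Theta1 - Theta2) ^+ 2.

Definition cube (R : realType) (m : nat) : set 'rV[R]_m :=
  [set x | forall j, 0 <= x 0 j <= 1].

(* [dg] is the partial derivative of [g] along the i-th coordinate on the closed
   cube.  The difference quotient ranges over the increments that stay in the
   cube, so that the derivative is one-sided on the boundary. *)
Definition is_partial (R : realType) (m : nat) (i : 'I_m)
    (g dg : 'rV[R]_m -> R) : Prop :=
  forall x, cube x ->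
    h^-1 * (g (x + h *: delta_mx 0 i) - g x)
      @[h --> within [set h : R | cube (x + h *: delta_mx 0 i)] 0^'] --> dg x.

(* ceil (alpha - 1); the absolute value is harmless since alpha > 0. *)
Definition holder_order (R : realType) (alpha : R) : nat :=
  `|Num.ceil (alpha - 1)|%N.

Definition multi_factorial (m : nat) (kappa : multinom m) : nat :=
  (\prod_(j < m) (kappa j)`!)%N.

(* [nabla kappa] is the mixed partial derivative of [f] of multi-index [kappa],
   independently of the order of the differentiations.  The first two clauses
   determine it on the cube for |kappa| <= s, and express that these
   derivatives exist.  The sum is over all multi-indices of degree s, and
   `|x - x0| is the sup norm of 'rV[R]_m. *)
Definition holder_class (R : realType) (m : nat) (alpha L : R)
    (f : 'rV[R]_m -> R) : Prop :=
  let s := holder_order alpha in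
  exists nabla : multinom m -> 'rV[R]_m -> R,
  [/\ forall x, cube x -> nabla mnm0 x = f x,
      forall kappa i, (mdeg kappa < s)%N ->
        is_partial i (nabla kappa)
                     (nabla (mnm_add kappa (mnm1 i)))
    & forall x x0, cube x -> cube x0 ->
        \sum_(kappa : bmultinom m s.+1
                | mdeg kappa == s)
           (multi_factorial kappa)%:R^-1
           * `|nabla kappa x - nabla kappa x0|
        <= L * `|x - x0| `^ (alpha - s%:R)].

(* A tensor of each dimension d, all of them sampled from the same function. *)
Definition smooth_tensors (R : realType) (m : nat) (alpha L : R)
    (Theta : forall d, tensor R m d) : Prop :=
  exists2 f : 'rV[R]_m -> R, holder_class alpha L f &
    forall d (i : tensor_index m d), Theta d i = f (\row_j ((i j).+1%:R / d%:R)).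

(* ceil (k i / d) for the 1-based index i.+1, as a natural number (d > 0). *)
Definition block_label (k d : nat) (i : 'I_d) : nat :=
  ((k * i.+1 + d.-1) %/ d)%N.

Definition block (m k d : nat) (i : tensor_index m d) : {ffun 'I_m -> nat} :=
  [ffun j => block_label k (i j)].

(* [mpoly.msize p] is 1 + the total degree of [p]. *)
Definition block_poly (R : realType) (m d k l : nat) : set (tensor R m d) :=
  [set B | exists p : {ffun 'I_m -> nat} -> mpoly m R,
     (forall b, (mpoly.msize (p b) <= l.+1)%N) /\
     (forall i : tensor_index m d,
        B i = meval (fun j => (i j).+1%:R) (p (block k i)))].

Definition is_lse (R : realType) (m d k l : nat) (Y Theta_hat : tensor R m d)
    (pi_hat : 'S_d) : Prop :=
  block_poly k l Theta_hat /\
  forall (Theta' : tensor R m d) (pi' : 'S_d), block_poly k l Theta' ->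
    frobenius (Y - tensor_perm Theta_hat pi_hat)
      <= frobenius (Y - tensor_perm Theta' pi').

Definition mutually_independent (R : realType) (disp : measure_display)
    (T : measurableType disp) (P : probability T R) (I : finType)
    (X : I -> {RV P >-> R}) : Prop :=
  forall (J : {set I}) (B : I -> set R), (forall i, measurable (B i)) ->
    P [set w | forall i, i \in J -> B i (X i w)]
      = (\prod_(i in J) P (X i @^-1` B i))%E.

Definition sub_gaussian (R : realType) (disp : measure_display)
    (T : measurableType disp) (P : probability T R) (sigma2 : R)
    (X : {RV P >-> R}) : Prop :=
  forall t : R, ('M_P X t <= (expR (sigma2 * t ^+ 2 / 2))%:E)%E.

Definition sub_gaussian_noise (R : realType) (disp : measure_display)
    (T : measurableType disp) (P : probability T R) (I : finType)
    (E : I -> {RV P >-> R}) : Prop :=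
  [/\ mutually_independent E,
      forall i, ('E_P[E i] = 0)%E
    & forall i, sub_gaussian 1 (E i)].

Definition observation (R : realType) (m d : nat) (disp : measure_display)
    (T : measurableType disp) (P : probability T R) (Theta : tensor R m d)
    (pi : 'S_d) (E : tensor_index m d -> {RV P >-> R}) (w : T) : tensor R m d :=
  [ffun i => tensor_perm Theta pi i + E i w].

(* An arbitrary selection of minimizers need not be measurable, so an event is
   only required to contain measurable events whose probability tends to 1.
   For measurable [A d] this says that P d (A d) tends to 1. *)
Definition with_high_probability (R : realType) (disp : nat -> measure_display)
    (T : forall d, measurableType (disp d)) (P : forall d, probability (T d) R)
    (A : forall d, set (T d)) : Prop :=
  exists B : forall d, set (T d),
  [/\ forall d, measurable (B d),
      forall d, B d `<=` A d
    & P d (B d) @[d --> \oo] --> 1%E].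

Definition lse_rate (R : realType) (m : nat) (alpha L : R) (d k l : nat) : R :=
  L ^+ 2 / k%:R `^ (2 * Num.min alpha (l.+1)%:R)
  + k%:R ^+ m * (l + m)%:R ^+ l / d%:R ^+ m
  + ln d%:R / d%:R ^+ m.-1.

Definition opt_degree (R : realType) (m : nat) (alpha : R) : nat :=
  minn (holder_order alpha) (((m - 2) * m.+1) %/ 2).

Definition opt_blocks (R : realType) (m : nat) (alpha c1 : R) (d : nat) : nat :=
  `|Num.ceil (c1 * d%:R `^ (m%:R / (m%:R + 2 * Num.min alpha
                                       (opt_degree m alpha).+1%:R)))|%N.

(* Main.v *)
(* The least squares error is controlled by comparing the estimator with a
   piecewise Taylor approximation B of the sampled function.  With
   D = Theta_hat o pi_hat - B o pi, minimality gives
   |D|^2 <= 2 <D, Theta o pi - B o pi> + 2 <D, E>, so everything reduces to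
   bounding <D, E>^2 / |D|^2.  For a fixed value rho of pi_hat, D lives in a space
   of dimension at most a constant times k^m (l + m)^l; a chi-square type tail
   bound on the projection of E, followed by a union bound over the d! values
   of rho, gives the last two terms of the rate.

   The tail bound does not use Gaussian decoupling or a volume argument.  If the
   coordinates of E in an orthonormal basis have norm at least sqrt t, rescale
   them to norm sqrt t, halve and round to an integer vector z: then
   <z, E> - |z|^2 >= (t - r) / 4, an event of probability at most
   exp (- |z|^2 / 2 - (t - r) / 4), and these bounds sum over z to at most
   5^r exp (- (t - r) / 4).

   The Taylor remainder is estimated by induction on its order, applying the
   one-variable mean value theorem to one coordinate at a time; this avoids any
   differentiability of the function in several variables at once. *)
Require Import Defs.
From mathcomp Require Import all_boot all_order all_algebra all_fingroup.
From mathcomp Require Import all_classical all_reals all_analysis.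
From mathcomp Require Import finmap measurable_realfun ring lra.
From mathcomp Require mpoly.
Import -(notations) mpoly.
Import Order.TTheory GRing.Theory Num.Theory.
Import numFieldNormedType.Exports.

Set Implicit Arguments.
Unset Strict Implicit.
Unset Printing Implicit Defensive.

Local Open Scope classical_set_scope.
Local Open Scope ring_scope.

(** * Orthonormalization and integer rounding *)

Definition dot (R : realType) (I : finType) (u v : I -> R) : R :=
  \sum_i u i * v i.

Section Dot.
Variables (R : realType) (I : finType).
Implicit Types u v w : I -> R.

Lemma dotC u v : dot u v = dot v u.
Proof. by apply: eq_bigr => i _; rewrite mulrC. Qed.

Lemma dot_suml (J : finType) (c : J -> R) (u : J -> I -> R) v :
  dot (fun x => \sum_j c j * u j x) v = \sum_j c j * dot (u j) v.
Proof.
rewrite /dot; under eq_bigr do rewrite mulr_suml.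
rewrite exchange_big /=; apply: eq_bigr => j _.
by rewrite mulr_sumr; apply: eq_bigr => i _; rewrite mulrA.
Qed.

Lemma dot_ge0 u : 0 <= dot u u.
Proof. by apply: sumr_ge0 => i _; rewrite -expr2 sqr_ge0. Qed.

Lemma dot_eq0 u : dot u u = 0 -> forall x, u x = 0.
Proof.
move/eqP; rewrite psumr_eq0; last by move=> i _; rewrite -expr2 sqr_ge0.
by move=> /allP u0 x; have := u0 x (mem_index_enum x); rewrite /= mulf_eq0 orbb => /eqP.
Qed.

Lemma cauchy_schwarz u v : dot u v ^+ 2 <= dot u u * dot v v.
Proof.
have [/eqP u0|u0] := boolP (dot u u == 0).
  rewrite {1}/dot big1; first by rewrite expr0n/= u0 mul0r.
  by move=> i _; rewrite (dot_eq0 u0) mul0r.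
have up : 0 < dot u u by rewrite lt0r u0 dot_ge0.
have key (a b : R) : dot (fun x => a * u x - b * v x) (fun x => a * u x - b * v x)
  = a ^+ 2 * dot u u - 2 * a * b * dot u v + b ^+ 2 * dot v v.
  rewrite /dot !mulr_sumr -sumrB -big_split /=.
  by apply: eq_bigr => i _; ring.
have := dot_ge0 (fun x => dot u v * u x - dot u u * v x); rewrite key.
move=> h; rewrite -(ler_pM2l up); move: h; nra.
Qed.

End Dot.

Section Orthonormal.
Variables (R : realType) (I : finType).

(** The family may be linearly dependent: a residual of norm zero stays in the list as a zero
    vector, so no basis has to be extracted and the index set is kept. *)
Lemma gram_schmidt (r : nat) (v : nat -> I -> R) :
  exists u : nat -> I -> R,
  [/\ forall i j, (i < r)%N -> (j < r)%N -> i != j -> dot (u i) (u j) = 0,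
      forall i, (i < r)%N -> dot (u i) (u i) = 0 \/ dot (u i) (u i) = 1
    & forall c : nat -> R, exists e : nat -> R,
        forall x, \sum_(j < r) c j * v j x = \sum_(j < r) e j * u j x].
Proof.
elim: r => [|r [u [uo un us]]].
  by exists v; split=> // c; exists c => x; rewrite !big_ord0.
pose w x := v r x - \sum_(j < r) dot (v r) (u j) * u j x.
pose n := Num.sqrt (dot w w).
(* If [n] is 0 then [w] vanishes, and division by 0 gives the zero vector. *)
pose u' j := if (j < r)%N then u j else fun x => w x / n.
have u'E j : (j < r)%N -> u' j = u j by rewrite /u' => ->.
have u'r x : u' r x = w x / n by rewrite /u' ltnn.
have n2 : n ^+ 2 = dot w w by rewrite sqr_sqrtr ?dot_ge0.
have dotwu i : (i < r)%N -> dot w (u i) = 0.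
  move=> ir; have -> : dot w (u i) = dot (v r) (u i)
     - dot (fun x => \sum_(j < r) dot (v r) (u j) * u j x) (u i).
    by rewrite /dot -sumrB; apply: eq_bigr => x _; rewrite /w mulrBl.
  rewrite dot_suml (bigD1 (Ordinal ir)) //= big1 ?addr0; last first.
    move=> j ji; rewrite uo ?mulr0 //.
  have [h|->] := un _ ir; last by rewrite mulr1 subrr.
  rewrite h mulr0 subr0 /dot big1 // => x _; by rewrite (dot_eq0 h) mulr0.
have dotu'u i : (i < r)%N -> dot (u' r) (u i) = 0.
  move=> ir; transitivity (n^-1 * dot w (u i)); last by rewrite dotwu ?mulr0.
  by rewrite /dot mulr_sumr; apply: eq_bigr => x _; rewrite u'r mulrAC mulrC.
exists u'; split.
- move=> i j; rewrite (ltnS i) (ltnS j) (leq_eqVlt i) (leq_eqVlt j) => /orP[/eqP->|ir] /orP[/eqP->|jr].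
  + by rewrite eqxx.
  + by rewrite (u'E j) // dotu'u.
  + by rewrite (u'E i) // dotC dotu'u.
  + by move=> ij; rewrite !u'E // uo.
- move=> i; rewrite ltnS leq_eqVlt => /orP[/eqP->|ir]; last by rewrite !u'E //; exact: un.
  have -> : dot (u' r) (u' r) = dot w w / n ^+ 2.
    rewrite /dot mulr_suml; apply: eq_bigr => x _; rewrite !u'r.
    by rewrite mulrACA -invfM -expr2.
  rewrite n2; have [->|nz] := eqVneq (dot w w) 0; first by rewrite mul0r; left.
  by rewrite divff //; right.
move=> c.
have [e he] := us (fun j => c j + c r * dot (v r) (u j)).
have [e1 he1] := us c.
exists (fun j => if (j < r)%N then e1 j + c r * dot (v r) (u j) else c r * n) => x.
rewrite !big_ord_recr /= ltnn he1.
have -> : \sum_(i < r) (if (i < r)%N then e1 i + c r * dot (v r) (u i) else c r * n) * u' i x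
   = \sum_(i < r) e1 i * u i x + c r * \sum_(j < r) dot (v r) (u j) * u j x.
  rewrite mulr_sumr -big_split /=; apply: eq_bigr => i _.
  by rewrite ltn_ord u'E // mulrDl mulrA.
rewrite -addrA; congr (_ + _); rewrite u'r.
have -> : c r * n * (w x / n) = c r * w x.
  have [n0|nz] := eqVneq n 0; last by field.
  have w0 : dot w w = 0 by rewrite -n2 n0 expr0n.
  by rewrite (dot_eq0 w0) mul0r !mulr0.
by rewrite /w; ring.
Qed.

Lemma bessel_span (r : nat) (u : nat -> I -> R) :
  (forall i j, (i < r)%N -> (j < r)%N -> i != j -> dot (u i) (u j) = 0) ->
  (forall i, (i < r)%N -> dot (u i) (u i) = 0 \/ dot (u i) (u i) = 1) ->
  forall (e : nat -> R) (D E : I -> R),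
  (forall x, D x = \sum_(j < r) e j * u j x) ->
  dot D E ^+ 2 <= dot D D * \sum_(j < r) dot (u j) E ^+ 2.
Proof.
move=> uo un e D E DE.
have Du j : (j < r)%N -> dot D (u j) = e j * dot (u j) (u j).
  move=> jr; have -> : D = fun x => \sum_(j < r) e j * u j x by apply/funext.
  rewrite dot_suml (bigD1 (Ordinal jr)) //= big1 ?addr0 // => i ij.
  by rewrite uo ?mulr0.
(* Weighting by the squared norm, 0 or 1, removes the coefficients along zero vectors, so [f j] is
   both a coefficient of [D] and its inner product with [u j]. *)
pose f j := e j * dot (u j) (u j).
have Df x : D x = \sum_(j < r) f j * u j x.
  rewrite DE; apply: eq_bigr => j _; rewrite /f.
  have [h|->] := un j (ltn_ord j); last by rewrite mulr1.
  by rewrite (dot_eq0 h) !mulr0.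
have dotD g : dot D g = dot (fun j : 'I_r => f j) (fun j : 'I_r => dot (u j) g).
  have -> : D = fun x => \sum_(j < r) f j * u j x by apply/funext.
  by rewrite dot_suml.
have DD : dot D D = dot (fun j : 'I_r => f j) (fun j : 'I_r => f j).
  by rewrite dotD; apply: eq_bigr => j _; rewrite dotC Du.
rewrite dotD DD; apply: le_trans (cauchy_schwarz _ _) _.
by under [X in _ <= _ * X]eq_bigr do rewrite expr2.
Qed.

End Orthonormal.

Section Grid.
Variable R : realType.

(** With q the integer nearest to b/2, q b - q^2 = b^2/4 - (q - b/2)^2, and the last square is at
    most 1/4. The grid stores q as q + M. *)
Lemma round_half (b : R) (M : nat) : (1 <= M)%N -> `|b| <= M%:R ->
  exists2 z : 'I_(M + M).+1, (b ^+ 2 - 1) / 4 <= (z%:R - M%:R) * b - (z%:R - M%:R) ^+ 2 &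
    0 <= (z%:R - M%:R) * b.
Proof.
move=> M1 bM.
pose q := Num.floor (b / 2 + 1 / 2).
have h1 : q%:~R <= b / 2 + 1 / 2 :> R by apply: floor_le_tmp.
have h2 : b / 2 + 1 / 2 < (q + 1)%:~R :> R by apply: floorD1_gt.
rewrite intrD in h2.
have M1' : 1 <= M%:R :> R by rewrite ler1n.
move: bM; rewrite ler_norml => /andP[b1 b2].
have qM : q <= M%:Z.
  by rewrite -(ler_int R); move: h1 h2; lra.
have qM' : - M%:Z <= q.
  rewrite -ltzD1 -(ltr_int R) intrD intrN; move: h1 h2; lra.
have zP : (absz (q + M%:Z)%R < (M + M).+1)%N.
  rewrite ltnS -lez_nat gez0_abs; last by rewrite -lerBlDr sub0r.
  by rewrite PoszD lerD2r.
exists (Ordinal zP) => /=.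
  have -> : (absz (q + M%:Z)%R)%:R - M%:R = q%:~R :> R.
    rewrite natr_absz ger0_norm; last by rewrite -lerBlDr sub0r.
    by rewrite intrD addrK.
  by move: h1 h2; nra.
have -> : (absz (q + M%:Z)%R)%:R - M%:R = q%:~R :> R.
  rewrite natr_absz ger0_norm; last by rewrite -lerBlDr sub0r.
  by rewrite intrD addrK.
have [q1|q1|->] := ltgtP q 0; last by rewrite mul0r.
  have : q%:~R <= -1 :> R by rewrite -[-1]/((-1)%:~R) ler_int -ltzD1.
  by move: h1 h2; nra.
have : 1 <= q%:~R :> R by rewrite -[1]/(1%:~R) ler_int.
by move: h1 h2; nra.
Qed.

(* Rescaling [a] to the sphere of radius sqrt t keeps the rounded vector in a finite grid. *)
Lemma grid_detect (r M : nat) (t : R) (a : nat -> R) : (1 <= M)%N -> 0 < t -> t <= M%:R ^+ 2 ->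
  t <= \sum_(j < r) a j ^+ 2 ->
  exists z : {ffun 'I_r -> 'I_(M + M).+1},
    \sum_j ((z j)%:R - M%:R) ^+ 2 + (t - r%:R) / 4 <= \sum_j ((z j)%:R - M%:R) * a j.
Proof.
move=> M1 t0 tM ta; set A := \sum_(j < r) _ in ta.
have A0 : 0 < A by apply: lt_le_trans ta.
pose s := Num.sqrt (t / A).
have s2 : s ^+ 2 = t / A by rewrite sqr_sqrtr ?divr_ge0 // ltW.
have s0 : 0 < s by rewrite sqrtr_gt0 divr_gt0.
have s1 : s <= 1.
  rewrite -(@ler_pXn2r _ 2) ?nnegrE ?ler01 ?(ltW s0)// expr1n s2.
  by rewrite ler_pdivrMr ?mul1r.
have bM j : (j < r)%N -> `|s * a j| <= M%:R.
  move=> jr; rewrite -(@ler_pXn2r _ 2) ?nnegrE ?normr_ge0 ?ler0n // real_normK ?num_real //.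
  apply: le_trans tM; rewrite exprMn s2 mulrAC ler_pdivrMr // ler_pM2l //.
  rewrite /A (bigD1 (Ordinal jr)) //= lerDl; apply: sumr_ge0 => *; exact: sqr_ge0.
have /choice[z hz] : forall j : 'I_r, exists z : 'I_(M + M).+1,
  ((s * a j) ^+ 2 - 1) / 4 <= (z%:R - M%:R) * (s * a j) - (z%:R - M%:R) ^+ 2 /\
    0 <= (z%:R - M%:R) * (s * a j).
  by move=> j; have [z h1 h2] := round_half M1 (bM j (ltn_ord j)); exists z.
exists [ffun j => z j].
under eq_bigr do rewrite ffunE.
under [X in _ <= X]eq_bigr do rewrite ffunE.
apply: (@le_trans _ _ (\sum_(j < r) ((z j)%:R - M%:R) * (s * a j))).
  rewrite addrC -lerBrDr -sumrB.
  apply: le_trans (ler_sum _ (fun j _ => (hz j).1)).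
  rewrite -mulr_suml sumrB sumr_const card_ord.
  have -> : \sum_(i < r) (s * a i) ^+ 2 = t.
    under eq_bigr do rewrite exprMn.
    by rewrite -mulr_sumr -/A s2 divfK // gt_eqF.
  by [].
(* All terms are nonnegative and [s <= 1], so removing the rescaling factor can only increase the
   sum. *)
apply: ler_sum => j _; have := (hz j).2.
rewrite mulrCA pmulr_rge0 // => h.
by rewrite ler_piMl.
Qed.

End Grid.

(** * Tails of linear combinations of independent sub-Gaussian variables *)

Section ProductExpectation.
Local Open Scope ereal_scope.
Context (disp : measure_display) (T : measurableType disp) (R : realType).
Variable P : probability T R.

Import HBNNSimple.

Let integral_mul_nnsfun (h : {nnsfun R >-> R}) (W X : T -> R) :
  measurable_fun setT W -> (forall w, 0 <= W w)%R -> measurable_fun setT X ->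
  let s := fset_set (range h) in
  \int[P]_w (W w * h (X w))%:E = \sum_(i < #|` s|)
     (s`_i)%:E * \int[P]_w (W w * \1_(h @^-1` [set s`_i]) (X w))%:E.
Proof.
move=> mW W0 mX s.
have m1 i : measurable_fun setT (fun w => (W w * \1_(h @^-1` [set s`_i]) (X w))%R).
  apply: measurable_funM => //.
  by apply: measurableT_comp => //; exact: measurable_indic.
have s0 (i : 'I_#|` s|) : (0 <= s`_i)%R.
  have : s`_i \in s by apply: mem_nth.
  by rewrite in_fset_set // => /set_mem [x _ <-].
under eq_integral => w _.
  have -> : ((W w * h (X w))%:E =
     \sum_(i < #|` s|) (s`_i)%:E * (W w * \1_(h @^-1` [set s`_i]) (X w))%:E).
    rewrite fimfunEord mulr_sumr -sumEFin; apply: eq_bigr => i _.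
    by rewrite -EFinM mulrCA.
  over.
rewrite ge0_integral_sum //.
- apply: eq_bigr => i _; rewrite ge0_integralZl //.
  + exact/measurable_EFinP.
  + by move=> w _; rewrite lee_fin mulr_ge0 // indicE.
  + by rewrite lee_fin.
- by move=> i; apply: measurable_funeM; exact/measurable_EFinP.
- move=> i w _; rewrite mule_ge0 ?lee_fin // mulr_ge0 // indicE //.
Qed.

(** The hypothesis covers indicators; linearity extends it to simple functions and monotone
    convergence to nonnegative measurable [f]. *)
Lemma integral_mul_comp (Z X : T -> R) (e : R) (f : R -> R) :
  measurable_fun setT Z -> (forall w, 0 <= Z w)%R ->
  measurable_fun setT X ->
  (forall C : set R, measurable C ->
     \int[P]_w (Z w * \1_C (X w))%:E = e%:E * P (X @^-1` C)) ->
  measurable_fun setT f -> (forall x, 0 <= f x)%R ->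
  \int[P]_w (Z w * f (X w))%:E = e%:E * \int[P]_w (f (X w))%:E.
Proof.
move=> mZ Z0 mX hC mf f0.
have mXC (C : set R) : measurable C -> measurable (X @^-1` C).
  by move=> mC; rewrite -(setTI (_ @^-1` _)); exact: mX.
have mef : measurable_fun [set: (R : measurableType _)] (fun x => (f x)%:E).
  exact/measurable_EFinP.
pose f_ := nnsfun_approx measurableT mef.
have f_cvg x : (f_ n x)%:E @[n --> \oo] --> (f x)%:E.
  by apply: (@cvg_nnsfun_approx _ _ _ _ measurableT _ mef) => // y _; rewrite lee_fin.
have f_nd x a b : (a <= b)%N -> (f_ a x <= f_ b x)%R.
  by move=> ab; exact/lefP/nd_nnsfun_approx.
have mfX n : measurable_fun setT (fun w => f_ n (X w)).
  by apply: measurableT_comp.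
have mZfX n : measurable_fun setT (fun w => (Z w * f_ n (X w))%R).
  exact: measurable_funM.
have simple n : \int[P]_w (Z w * f_ n (X w))%:E = e%:E * \int[P]_w (f_ n (X w))%:E.
  rewrite (integral_mul_nnsfun (f_ n) mZ Z0 mX).
  have -> : \int[P]_w (f_ n (X w))%:E = \int[P]_w (cst 1%R w * f_ n (X w))%:E.
    by apply: eq_integral => w _; rewrite /= mul1r.
  rewrite (integral_mul_nnsfun (f_ n) _ _ mX) //.
  set s := fset_set _.
  have s0 (i : 'I_#|` s|) : (0 <= s`_i)%R.
    have : s`_i \in s by apply: mem_nth.
    by rewrite in_fset_set // => /set_mem [x _ <-].
  rewrite ge0_sume_distrr; last first.
    move=> i _; rewrite mule_ge0 ?lee_fin //; apply: integral_ge0 => w _.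
    by rewrite lee_fin mulr_ge0.
  apply: eq_bigr => i _; rewrite hC // muleCA; congr (_ * (_ * _)).
  under eq_integral do rewrite mul1r.
  rewrite -[X in P X]setIT -integral_indic //; last exact: mXC.
transitivity (limn (fun n => \int[P]_w (Z w * f_ n (X w))%:E)).
  rewrite -monotone_convergence//=.
  - apply: eq_integral => w _; apply/esym/cvg_lim => //=.
    under eq_fun do rewrite EFinM.
    by rewrite EFinM; apply: cvgeZl => //; exact: f_cvg.
  - by move=> n; exact/measurable_EFinP.
  - by move=> n x _; rewrite lee_fin mulr_ge0.
  - by move=> x _ a b ab; rewrite lee_fin ler_wpM2l// f_nd.
rewrite [X in _ = _ * X](_ : _ = limn (fun n => \int[P]_w (f_ n (X w))%:E)); last first.
  rewrite -monotone_convergence//=.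
  - by apply: eq_integral => w _; apply/esym/cvg_lim => //=; exact: f_cvg.
  - by move=> n; exact/measurable_EFinP.
  - by move=> n x _; rewrite lee_fin.
  - by move=> x _ a b ab; rewrite lee_fin f_nd.
rewrite -limeMl//; first by congr (limn _); apply/funext => n; exact: simple.
apply/ereal_nondecreasing_is_cvgn => a b ab; apply: ge0_le_integral => //.
- by move=> x _; rewrite lee_fin.
- exact/measurable_EFinP.
- exact/measurable_EFinP.
- by move=> x _; rewrite lee_fin f_nd.
Qed.

(* Independence is the case where every factor is an indicator; the factors are
   replaced by the functions [f i] one index at a time. *)
Lemma expectation_prod_indep (I : finType) (X : I -> {RV P >-> R})
    (f : I -> R -> R) (a : I -> R) :
  mutually_independent X ->
  (forall i, measurable_fun setT (f i)) -> (forall i x, 0 <= f i x)%R ->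
  (forall i, \int[P]_w (f i (X i w))%:E = (a i)%:E) ->
  \int[P]_w (\prod_i f i (X i w))%:E = (\prod_i a i)%:E.
Proof.
move=> indX mf f0 fa.
(* Indices in [s] already carry [f i], the others still carry indicators of arbitrary measurable
   sets; this freedom in [B] feeds the induction. *)
pose F (s : seq I) (B : I -> set R) i x : R := if i \in s then f i x else \1_(B i) x.
pose b (s : seq I) (B : I -> set R) i : R := if i \in s then a i else fine (P (X i @^-1` B i)).
have mXB i (C : set R) : measurable C -> measurable (X i @^-1` C).
  by move=> mC; rewrite -(setTI (_ @^-1` _)); exact: measurable_funP.
have mF s B i : (forall i, measurable (B i)) -> measurable_fun setT (F s B i).
  move=> mB; rewrite /F; case: (i \in s) => //; exact: measurable_indic.
have F0 s B i x : (0 <= F s B i x)%R.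
  by rewrite /F; case: ifP => _ //; rewrite indicE.
suff claim s : uniq s -> forall B, (forall i, measurable (B i)) ->
    \int[P]_w (\prod_i F s B i (X i w))%:E = (\prod_i b s B i)%:E.
  have /(_ (fun=> setT) (fun=> measurableT)) := claim (enum I) (enum_uniq I).
  rewrite (eq_bigr a); last by move=> i _; rewrite /b mem_enum.
  move=> <-; apply: eq_integral => w _; congr (_%:E); apply: eq_bigr => i _.
  by rewrite /F mem_enum.
elim: s => [_ B mB|i s IH /= /andP[ins us] B mB].
  have := indX (finset.setTfor I) B mB.
  rewrite (_ : \prod_(i in _) _ = (\prod_i b [::] B i)%:E); last first.
    rewrite -prodEFin; apply: eq_big => [i|i _]; first by rewrite inE.
    by rewrite /b /= fineK // fin_num_measure //; exact: mXB.
  move=> <-.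
  rewrite (_ : [set w | _] = \bigcap_(i in [set: I]) (X i @^-1` B i)); last first.
    by apply/seteqP; split => w /= h i _; apply: h; rewrite ?finset.in_setT.
  have mcap : measurable (\bigcap_(i in [set: I]) (X i @^-1` B i)).
    by apply: fin_bigcap_measurable => // i _; exact: mXB.
  rewrite -[X in P X]setIT -integral_indic //.
  apply: eq_integral => w _; congr (_%:E); rewrite /F /= indicE.
  have [h|h] := boolP (w \in _).
    rewrite big1 // => i _; rewrite indicE mem_set //.
    by have := set_mem h; apply.
  have [i hi] : exists i, ~ B i (X i w).
    apply: contrapT => hn; move/negP: h; apply; apply: mem_set => i _.
    by apply: contrapT => ?; apply: hn; exists i.
  by rewrite (bigD1 i) //= indicE memNset // mul0r.
pose Z w : R := (\prod_(j | j != i) F s B j (X j w))%R.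
have mZ : measurable_fun setT Z.
  rewrite /Z; under eq_fun do rewrite big_mkcond /=.
  apply: measurable_prod => j _; case: (j != i) => //.
  apply: measurableT_comp => //; exact: mF.
have Z0 w : (0 <= Z w)%R by rewrite prodr_ge0.
pose e : R := (\prod_(j | j != i) b s B j)%R.
have key : \int[P]_w (Z w * f i (X i w))%:E = e%:E * \int[P]_w (f i (X i w))%:E.
  apply: integral_mul_comp => // C mC.
  (* Setting the [i]-th set to [C] in the induction hypothesis gives the factorization for
     indicators required at index [i]. *)
  pose B' j := if j == i then C else B j.
  have mB' j : measurable (B' j) by rewrite /B'; case: ifP.
  have := IH us B' mB'.
  rewrite [in X in _ = X -> _](bigD1 i) //= {1}/b (negbTE ins) /B' eqxx.
  rewrite EFinM fineK; last by rewrite fin_num_measure //; exact: mXB.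
  rewrite muleC (_ : (\prod_(j | j != i) _)%R = e); last first.
    by apply: eq_bigr => j ji; rewrite /b (negbTE ji).
  move=> <-; apply: eq_integral => w _; congr (_%:E).
  rewrite [RHS](bigD1 i) //= {1}/F (negbTE ins) eqxx mulrC; congr (_ * _)%R.
  by apply: eq_bigr => j ji; rewrite /F (negbTE ji).
rewrite (bigD1 i) //= {1}/b mem_head mulrC EFinM -fa.
rewrite (_ : (\prod_(j | j != i) _)%R = e); last first.
  by apply: eq_bigr => j ji; rewrite /b inE (negbTE ji).
rewrite -key; apply: eq_integral => w _; congr (_%:E).
rewrite (bigD1 i) //= {1}/F mem_head mulrC; congr (_ * _)%R.
by apply: eq_bigr => j ji; rewrite /F inE (negbTE ji).
Qed.

(** Chernoff's bound with exponential parameter 1: the scaling is left to [c], and independence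
    factorizes the moment generating function of the sum. *)
Lemma sub_gaussian_tail (I : finType) (X : I -> {RV P >-> R}) (c : I -> R) (t : R) :
  sub_gaussian_noise X ->
  P [set w | t <= \sum_i c i * X i w]%R
    <= (expR ((\sum_i c i ^+ 2) / 2 - t))%:E.
Proof.
move=> [indX _ sg].
have mS : measurable_fun setT (fun w => (\sum_i c i * X i w)%R).
  by apply: measurable_sum => i; apply: measurable_funM.
have mgf i : \int[P]_w (expR (c i * X i w))%:E <= (expR (c i ^+ 2 / 2))%:E.
  have := sg i (c i); rewrite mul1r /mmt_gen_fun unlock; apply: le_trans.
  rewrite le_eqVlt; apply/orP; left; apply/eqP.
  by apply: eq_integral => w _ /=; rewrite mulrC.
pose a i := fine (\int[P]_w (expR (c i * X i w))%:E).
have I0 i : 0 <= \int[P]_w (expR (c i * X i w))%:E.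
  by apply: integral_ge0 => w _; rewrite lee_fin expR_ge0.
have aE i : \int[P]_w (expR (c i * X i w))%:E = (a i)%:E.
  rewrite fineK // ge0_fin_numE //; apply: le_lt_trans (mgf i) _; exact: ltry.
have mexp i : measurable_fun setT (fun x : R => expR (c i * x)).
  by apply: measurableT_comp => //; apply: measurable_funM.
have mprod : measurable_fun setT (fun w => (\prod_i expR (c i * X i w))%:E).
  apply/measurable_EFinP; apply: measurable_prod => i _.
  exact: (measurableT_comp (mexp i)).
have prodE := expectation_prod_indep (f := fun i x => expR (c i * x)) indX
  mexp (fun _ _ => expR_ge0 _) aE.
have mA : measurable [set w | t <= \sum_i c i * X i w]%R.
  by rewrite -[X in measurable X]setTI; apply: measurable_fun_le.
rewrite -[X in P X]setIT -integral_indic //.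
apply: (@le_trans _ _ (\int[P]_w ((expR (- t))%:E * (\prod_i expR (c i * X i w))%:E))).
  apply: ge0_le_integral => //.
  - exact/measurable_EFinP/measurable_indic.
  - exact: measurable_funeM.
  - move=> w _; rewrite -EFinM lee_fin -expR_sum -expRD indicE.
    have [|_] := boolP (w \in _); last by rewrite expR_ge0.
    by move=> /set_mem /= h; rewrite -expR0 ler_expR addrC subr_ge0.
rewrite ge0_integralZl ?lee_fin ?expR_ge0 //; last first.
  by move=> w _; rewrite lee_fin prodr_ge0 // => i _; exact: expR_ge0.
rewrite prodE.
rewrite -EFinM lee_fin expRD mulrC ler_wpM2r ?expR_ge0 //.
rewrite mulr_suml expR_sum; apply: ler_prod => i _.
by rewrite -!lee_fin -aE I0 mgf.
Qed.

End ProductExpectation.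

(** * Projection of the noise on a subspace *)

Section GaussianGrid.
Variable R : realType.

(** Since n^2 >= n and exp (1/2) >= 3/2, Gaussian weights are dominated by a geometric sequence. *)
Lemma expRN_half_sqr (n : nat) : expR (- (n%:R ^+ 2 / 2)) <= (2 / 3) ^+ n :> R.
Proof.
have h : expR (- (1 / 2)) <= 2 / 3 :> R.
  have := expR_ge1Dx (1 / 2 : R); have := expR_gt0 (1 / 2 : R).
  rewrite expRN => h0 h1.
  by rewrite -[2 / 3]invrK lef_pV2 ?posrE ?invr_gt0 //; lra.
apply: (@le_trans _ _ (expR (n%:R * - (1 / 2)))); last first.
  by rewrite expRM_natl; apply: lerXn2r; rewrite ?nnegrE ?expR_ge0.
rewrite ler_expR.
have [->|n0] := posnP n; first by rewrite expr0n /=; lra.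
have : 1 <= n%:R :> R by rewrite ler1n.
nra.
Qed.

Lemma sum_gaussian_grid (M : nat) :
  \sum_(z < (M + M).+1) expR (- ((z%:R - M%:R) ^+ 2 / 2)) <= 5 :> R.
Proof.
(* The stronger bound is the partial sum 1 + 2 (2/3 + ... + (2/3)^M), which makes the induction
   close. *)
suff: \sum_(z < (M + M).+1) expR (- ((z%:R - M%:R) ^+ 2 / 2)) <= 5 - 4 * (2 / 3) ^+ M :> R.
  move=> h; apply: le_trans h _.
  have : 0 <= (2 / 3) ^+ M :> R by apply: exprn_ge0.
  lra.
elim: M => [|M IH].
  by rewrite big_ord_recl big_ord0 subrr expr0n /= mul0r oppr0 expR0 expr0; lra.
rewrite addSn addnS big_ord_recl big_ord_recr /=.
have -> : \sum_(i < (M + M).+1) expR (- (((bump 0 i)%:R - M.+1%:R) ^+ 2 / 2)) =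
  \sum_(i < (M + M).+1) expR (- ((i%:R - M%:R) ^+ 2 / 2)) :> R.
  apply: eq_bigr => i _; congr (expR (- (_ ^+ 2 / 2))).
  rewrite /bump /= add1n -[(nat_of_ord i).+1]addn1 -[M.+1]addn1 !natrD; ring.
have -> : (0 - M.+1%:R) ^+ 2 = M.+1%:R ^+ 2 :> R by rewrite sub0r sqrrN.
have -> : (bump 0 (M + M).+1)%:R - M.+1%:R = M.+1%:R :> R.
  by rewrite (_ : bump 0 (M + M).+1 = (M.+1 + M.+1)%N) ?natrD ?addrK // /bump leq0n add1n addSn addnS.
have := expRN_half_sqr M.+1; rewrite (exprS (2 / 3) M); move: IH; lra.
Qed.

End GaussianGrid.

Lemma measure_fin_bigcup_le (disp : measure_display) (T : measurableType disp)
    (R : realType) (P : {measure set T -> \bar R}) (K : finType) (A : K -> set T) :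
  (forall j, measurable (A j)) ->
  (P (\bigcup_(j in [set: K]) A j) <= \sum_j P (A j))%E.
Proof.
move=> mA.
have -> : \bigcup_(j in [set: K]) A j = \big[setU/set0]_j A j.
  rewrite -bigcup_seq; congr (bigcup _ _); apply/seteqP; split=> j _ //=; exact: mem_index_enum.
pose K' (B : set T) (x : \bar R) := measurable B /\ (P B <= x)%E.
suff [] : K' (\big[setU/set0]_j A j) (\sum_j P (A j))%E by [].
apply: (big_ind2 K'); first by split; rewrite ?measure0.
- move=> B x C y [mB Bx] [mC Cy]; split; first exact: measurableU.
  apply: le_trans (measureU2 _ mB mC) _; exact: leeD.
- by move=> j _; split.
Qed.

Section SpanTail.
Context (disp : measure_display) (T : measurableType disp) (R : realType).
Variables (P : probability T R) (I : finType) (X : I -> {RV P >-> R}).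
Hypothesis hX : sub_gaussian_noise X.

(** The event [G], a union over grid vectors, is fixed before [D], so the bound holds on the whole
    span at once. Outside [G], [grid_detect] forces the squared inner products with the
    orthonormalized family to sum to at most [t], and Bessel's inequality concludes. *)
Lemma sub_gaussian_span_tail (J : finType) (v : J -> I -> R) (t : R) : 0 < t ->
  exists G : set T,
  [/\ measurable G,
      (P G <= (expR (13 / 4 * #|J|%:R - t / 4))%:E)%E
    & forall w, ~ G w -> forall c : J -> R, forall D : I -> R,
        (forall x, D x = \sum_j c j * v j x) ->
        dot D (fun i => X i w) ^+ 2 <= t * dot D D].
Proof.
move=> t0; pose r := #|J|.
pose v' n : I -> R := if insub n is Some i then v (@enum_val J predT i) else fun=> 0.
have [u [uo un us]] := gram_schmidt r v'.
(* A grid radius above [t], hence with t <= M^2 as [grid_detect] requires. *)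
pose M := (Num.truncn t).+1.
have M1 : (1 <= M)%N by [].
have tM : t <= M%:R ^+ 2.
  have tM : t <= M%:R by rewrite ltW // truncnS_gt.
  apply: le_trans tM _; rewrite expr2 ler_peMl ?ler0n // ler1n //.
pose g (z : 'I_(M + M).+1) : R := z%:R - M%:R.
pose n2 (z : {ffun 'I_r -> 'I_(M + M).+1}) : R := \sum_j g (z j) ^+ 2.
pose cz (z : {ffun 'I_r -> 'I_(M + M).+1}) i : R := \sum_j g (z j) * u j i.
pose B z := [set w : T | n2 z + (t - r%:R) / 4 <= \sum_i cz z i * X i w].
have mB z : measurable (B z).
  rewrite -[X in measurable X]setTI; apply: measurable_fun_le => //.
  by apply: measurable_sum => i; apply: measurable_funM.
exists (\bigcup_(z in [set: {ffun 'I_r -> 'I_(M + M).+1}]) B z); split.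
- exact: fin_bigcup_measurable.
- have cz2 z : \sum_i cz z i ^+ 2 <= n2 z.
    have -> : \sum_i cz z i ^+ 2 = \sum_(j < r) g (z j) * (g (z j) * dot (u j) (u j)).
      transitivity (dot (cz z) (cz z)); first by apply: eq_bigr => i _; rewrite expr2.
      rewrite {1}/cz dot_suml; apply: eq_bigr => j _; congr (_ * _).
      rewrite dotC {1}/cz dot_suml (bigD1 j) //= big1 ?addr0 // => i ij.
      by rewrite uo ?mulr0.
    apply: ler_sum => j _.
    by have [->|->] := un j (ltn_ord j); rewrite ?mulr0 ?mulr1 -?expr2 ?sqr_ge0.
  (* The tail exponent |cz|^2 / 2 - n2 - (t - r) / 4 is at most - n2 / 2 - (t - r) / 4, and exp (-
     n2 / 2) is a product over coordinates. *)
  have PB z : (P (B z) <= (expR (- ((t - r%:R) / 4)) * \prod_j expR (- (g (z j) ^+ 2 / 2)))%:E)%E.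
    apply: le_trans (sub_gaussian_tail _ _ hX) _.
    rewrite lee_fin -expR_sum -expRD ler_expR sumrN -mulr_suml -/(n2 z).
    by have := cz2 z; lra.
  apply: le_trans (measure_fin_bigcup_le P mB) _.
  apply: le_trans (lee_sum _ (fun z _ => PB z)) _.
  rewrite sumEFin lee_fin -mulr_sumr.
  have -> : \sum_(z : {ffun 'I_r -> 'I_(M + M).+1}) \prod_j expR (- (g (z j) ^+ 2 / 2))
     = (\sum_(z < (M + M).+1) expR (- (g z ^+ 2 / 2))) ^+ r.
    by rewrite -(bigA_distr_bigA (fun _ z => expR (- (g z ^+ 2 / 2)))) prodr_const card_ord.
  (* From 5 <= 2^3 <= exp 3 one gets 5^r <= exp (3 r); together with r / 4 this is the constant
     13/4. *)
  apply: (@le_trans _ _ (expR (- ((t - r%:R) / 4)) * expR (3 * r%:R))).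
    rewrite ler_wpM2l ?expR_ge0 // mulrC expRM_natl.
    apply: lerXn2r; rewrite ?nnegrE ?expR_ge0 ?sumr_ge0//.
    apply: le_trans (sum_gaussian_grid _ _) _.
    have := expR_ge1Dx (1 : R).
    have -> : 3 = 3%:R * 1 :> R by rewrite mulr1.
    rewrite expRM_natl => h; apply: (@le_trans _ _ (2 ^+ 3)); first by lra.
    by apply: lerXn2r; rewrite ?nnegrE ?expR_ge0 //; lra.
  by rewrite -expRD ler_expR -/r; lra.
move=> w nG c D DE.
have [e he] := us (fun n => if insub n is Some i then c (@enum_val J predT i) else 0).
have De x : D x = \sum_(j < r) e j * u j x.
  rewrite DE -he (reindex_onto (@enum_val J predT) (@enum_rank J)); last by move=> i _; rewrite enum_rankK.
  apply: eq_big => [i|i _]; first by rewrite enum_valK eqxx.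
  by rewrite /v' valK.
apply: le_trans (bessel_span uo un _ De) _.
rewrite mulrC ler_wpM2r ?dot_ge0 //.
rewrite leNgt; apply/negP => lt_t.
have [z hz] := @grid_detect _ r M t (fun j => dot (u j) (fun i => X i w)) M1 t0 tM (ltW lt_t).
apply: nG; exists z => //; rewrite /B /=.
apply: le_trans hz _.
rewrite le_eqVlt; apply/orP; left; apply/eqP.
by rewrite -/(dot (cz z) (fun i => X i w)) /cz dot_suml.
Qed.

End SpanTail.

(** * Spaces of block-wise polynomial tensors *)

Lemma mnm_neq0 (n : nat) (mu : multinom n) : mu != @mnm0 n -> exists i, mu i != 0%N.
Proof.
move=> /negP mu0; apply: contrapT => h; apply: mu0; apply/eqP/mnmP => i.
by rewrite mnm0E; apply/eqP/negPn/negP => ?; apply: h; exists i.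
Qed.

(** A monomial of degree at most [c] is a word of length [c] whose letters are variables or blanks
    ([None]). *)
Lemma mnm_sum_option (n c : nat) (mu : multinom n) : (mdeg mu <= c)%N ->
  exists g : 'I_c -> option 'I_n,
    mu = \big[@mnm_add n/@mnm0 n]_t (if g t is Some i then mnm1 i else @mnm0 n).
Proof.
elim: c mu => [|c IH] mu.
  by rewrite leqn0 mdeg_eq0 => /eqP ->; exists (fun=> None); rewrite big_ord0.
move=> muc; have [mu0|[i mui]] : mu = @mnm0 n \/ exists i, mu i != 0%N.
- by have [->|/mnm_neq0] := eqVneq mu (@mnm0 n); [left|right].
- exists (fun=> None); rewrite big1 //.
have muE : mu = mnm_add (mnm1 i) (mnm_sub mu (mnm1 i)).
  by rewrite addmC submK // lep1mP.
have [|g gE] := IH (mnm_sub mu (mnm1 i)).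
  by move: muc; rewrite {1}muE mdegD mdeg1 add1n ltnS.
exists (fun t => if unlift ord0 t is Some t' then g t' else Some i).
rewrite big_ord_recl unlift_none {1}muE; congr mnm_add; rewrite gE.
by apply: eq_bigr => t _; rewrite liftK.
Qed.

(** Counting words over the variables and a blank gives (n + 1)^b, at most (b + n)^b for positive
    [b]. *)
Lemma card_bmultinom_le (n b : nat) : (0 < n)%N ->
  (#|{: bmultinom n b.+1}| <= (b + n) ^ b)%N.
Proof.
move=> n0.
have [->|b0] := posnP b.
  rewrite expn0; apply: (@leq_trans #|'I_1|); last by rewrite card_ord.
  apply: (@leq_card _ _ (fun=> ord0)) => x y _.
  apply/eqP; rewrite bmeqP; have := bmdeg x; have := bmdeg y.
  by rewrite !ltnS !leqn0 !mdeg_eq0 => /eqP-> /eqP->.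
have /choice[G hG] : forall mu : bmultinom n b.+1, exists g : {ffun 'I_b -> option 'I_n},
    bmnm mu = \big[@mnm_add n/@mnm0 n]_t (if g t is Some i then mnm1 i else @mnm0 n).
  move=> mu; have := bmdeg mu; rewrite ltnS => /mnm_sum_option[g ->].
  by exists [ffun t => g t]; apply: eq_bigr => t _; rewrite ffunE.
apply: (@leq_trans #|{: {ffun 'I_b -> option 'I_n}}|).
  apply: (@leq_card _ _ G) => x y Gxy; apply/eqP.
  by rewrite bmeqP hG Gxy -hG.
by rewrite card_ffun card_option !card_ord leq_exp2r // -add1n leq_add2r.
Qed.

(* The labels lie in {1, ..., k}; allowing the extra value 0 avoids a shift and
   only costs a factor 2 ^ m in the dimension. *)
Definition block_monomial (R : realType) (m d k l : nat)
    (a : {ffun 'I_m -> 'I_k.+1} * bmultinom m l.+1) (i : tensor_index m d) : R :=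
  (block k i == [ffun j => nat_of_ord (a.1 j)])%:R * \prod_j (i j).+1%:R ^+ a.2 j.

Lemma block_poly_span (R : realType) (m d k l : nat) (B : tensor R m d) :
  (0 < d)%N -> block_poly k l B ->
  exists c : {ffun 'I_m -> 'I_k.+1} * bmultinom m l.+1 -> R,
    forall i, B i = \sum_a c a * block_monomial R a i.
Proof.
move=> d0 [p [psize pE]].
exists (fun a : {ffun 'I_m -> 'I_k.+1} * bmultinom m l.+1 =>
  mcoeff (bmnm a.2) (p [ffun j => nat_of_ord (a.1 j)])) => i.
have lab j : (block_label k (i j) < k.+1)%N.
  rewrite /block_label ltn_divLR // mulSn addnC -addSn prednK //.
  by rewrite leq_add2l leq_mul2l ltn_ord orbT.
pose b : {ffun 'I_m -> 'I_k.+1} := [ffun j => Ordinal (lab j)].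
have bE : block k i = [ffun j => nat_of_ord (b j)].
  by apply/ffunP => j; rewrite !ffunE.
rewrite -(pair_bigA _ (fun (b' : {ffun 'I_m -> 'I_k.+1}) (mu : bmultinom m l.+1) =>
   mcoeff (bmnm mu) (p [ffun j => nat_of_ord (b' j)])
   * block_monomial R (b', mu) i)) /= (bigD1 b) //= [X in _ = _ + X]big1 ?addr0.
  rewrite pE bE {1}(mpolywE (psize _)) raddf_sum /=; apply: eq_bigr => mu _.
  by rewrite mevalZ mevalX /block_monomial /= bE eqxx mul1r.
move=> b' bb'; apply: big1 => mu _; rewrite /block_monomial /=.
rewrite (_ : (block k i == _) = false) ?mul0r ?mulr0 //.
apply: contra_neqF bb' => /eqP; rewrite bE => /ffunP h.
by apply/ffunP => j; apply/val_inj; have := h j; rewrite !ffunE.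
Qed.

Section NoiseEvent.
Context (disp : measure_display) (T : measurableType disp) (R : realType).
Variables (P : probability T R) (m d k l : nat).
Variable (X : tensor_index m d -> {RV P >-> R}).
Hypotheses (m0 : (0 < m)%N) (d0 : (0 < d)%N) (k0 : (0 < k)%N).
Hypothesis hX : sub_gaussian_noise X.

(** For fixed [rho] the difference lies in the span of the block monomials permuted by [rho]
    together with those permuted by [pi], which doubles the dimension and turns 13/4 into 13/2. A
    union bound over [rho] then costs at most d^d. *)
Lemma sub_gaussian_block_tail (pi : 'S_d) (t : R) : 0 < t ->
  exists G : set T,
  [/\ measurable G,
      (P G <= (d%:R ^+ d * expR (13 / 2 * (2 ^ m * (k ^ m * (l + m) ^ l))%:R - t / 4))%:E)%E
    & forall w, ~ G w -> forall (rho : 'S_d) (B B' : tensor R m d),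
        block_poly k l B -> block_poly k l B' ->
        dot (tensor_perm B rho - tensor_perm B' pi) (fun i => X i w) ^+ 2 <=
        t * dot (tensor_perm B rho - tensor_perm B' pi)
                (tensor_perm B rho - tensor_perm B' pi)].
Proof.
move=> t0.
pose A := ({ffun 'I_m -> 'I_k.+1} * bmultinom m l.+1)%type.
(* The factor 2^m comes from (k + 1)^m <= (2 k)^m. *)
have cardA : (#|{: A}| <= 2 ^ m * (k ^ m * (l + m) ^ l))%N.
  rewrite card_prod card_ffun !card_ord mulnA leq_mul ?card_bmultinom_le //.
  by rewrite -expnMn leq_exp2r // mul2n -addnn -addn1 leq_add2l.
pose act (rho : 'S_d) (i : tensor_index m d) : tensor_index m d := [ffun j => rho (i j)].
pose v rho (a : A + A) i := match a with
  | inl a => block_monomial R a (act rho i)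
  | inr a => block_monomial R a (act pi i) end.
have /choice[G hG] : forall rho, exists G : set T,
  [/\ measurable G,
      (P G <= (expR (13 / 4 * #|{: A + A}|%:R - t / 4))%:E)%E
    & forall w, ~ G w -> forall c : A + A -> R, forall D : tensor_index m d -> R,
        (forall x, D x = \sum_j c j * v rho j x) ->
        dot D (fun i => X i w) ^+ 2 <= t * dot D D].
  move=> rho; exact: sub_gaussian_span_tail.
exists (\bigcup_(rho in [set: 'S_d]) G rho); split.
- by apply: fin_bigcup_measurable => [|rho _]; [exact: finite_finset|case: (hG rho)].
- apply: le_trans (measure_fin_bigcup_le P _) _; first by move=> rho; case: (hG rho).
  apply: (@le_trans _ _ (\sum_(rho : 'S_d)
     (expR (13 / 2 * (2 ^ m * (k ^ m * (l + m) ^ l))%:R - t / 4))%:E)%E).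
    apply: lee_sum => rho _; have [_ + _] := hG rho; move=> /le_trans; apply.
    rewrite lee_fin ler_expR card_sum natrD.
    have : #|{: A}|%:R <= (2 ^ m * (k ^ m * (l + m) ^ l))%:R :> R by rewrite ler_nat.
    set x := #|_|%:R; set y := (2 ^ m * _)%:R; lra.
  rewrite sumEFin lee_fin sumr_const -[X in X <= _]mulr_natl ler_wpM2r ?expR_ge0 //.
  rewrite -natrX ler_nat.
  apply: (@leq_trans #|{: {ffun 'I_d -> 'I_d}}|); last by rewrite card_ffun card_ord.
  by apply: (@leq_card _ _ (@pval _)); exact: val_inj.
move=> w nG rho B B' hB hB'.
have [c cE] := block_poly_span d0 hB; have [c' cE'] := block_poly_span d0 hB'.
have [_ _ h] := hG rho.
apply: (h w _ (fun a => match a with inl a => c a | inr a => - c' a end)).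
  by move=> Gw; apply: nG; exists rho.
move=> i; rewrite big_sumType /= !ffunE cE cE' -sumrN; congr (_ + _).
by apply: eq_bigr => a _; rewrite mulNr.
Qed.

End NoiseEvent.

(** * Taylor approximation of Hölder functions *)

Section PartialDerivatives.
Variables (R : realType) (m : nat).
Implicit Types (x y z : 'rV[R]_m) (g dg : 'rV[R]_m -> R) (i : 'I_m).

(* Unlike [is_partial], the increment h = 0 is allowed here. *)
Definition has_partial i g dg := forall x, cube x -> forall e : R, 0 < e ->
  exists2 r : R, 0 < r & forall h, `|h| < r -> cube (x + h *: delta_mx 0 i) ->
    `|g (x + h *: delta_mx 0 i) - g x - h * dg x| <= e * `|h|.

Lemma is_partialW i g dg : is_partial i g dg -> has_partial i g dg.
Proof.
move=> hp x cx e e0.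
have /cvgrPdist_lt/(_ e e0) := hp x cx.
rewrite near_withinE => -[r /= r0 hr]; exists r => // h hr' ch.
have [->|h0] := eqVneq h 0; first by rewrite scale0r addr0 subrr sub0r mul0r oppr0 normr0 mulr0.
have := hr h; rewrite /ball_ /= sub0r normrN => /(_ hr' h0 ch) hlt.
have -> : g (x + h *: delta_mx 0 i) - g x - h * dg x =
   - h * (dg x - h^-1 * (g (x + h *: delta_mx 0 i) - g x)).
  by field.
by rewrite normrM normrN mulrC ler_wpM2r // ltW.
Qed.

Lemma has_partialB i g dg g' dg' : has_partial i g dg -> has_partial i g' dg' ->
  has_partial i (fun x => g x - g' x) (fun x => dg x - dg' x).
Proof.
move=> hg hg' x cx e e0; have e20 : 0 < e / 2 by rewrite divr_gt0.
have [r r0 hr] := hg x cx _ e20; have [r' r'0 hr'] := hg' x cx _ e20.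
exists (Num.min r r'); first by rewrite lt_min r0.
move=> h; rewrite lt_min => /andP[h1 h2] ch.
set y := x + _ in ch *.
have -> : g y - g' y - (g x - g' x) - h * (dg x - dg' x) =
  (g y - g x - h * dg x) - (g' y - g' x - h * dg' x) by ring.
apply: le_trans (ler_normB _ _) _.
by have := hr h h1 ch; have := hr' h h2 ch; rewrite -/y; lra.
Qed.

Lemma coord_shiftE x (h : R) i j :
  (x + h *: delta_mx 0 i) 0 j = x 0 j + h * (j == i)%:R.
Proof. by rewrite !mxE eqxx. Qed.

Lemma cube_shift x (h : R) i : cube x -> 0 <= x 0 i + h <= 1 ->
  cube (x + h *: delta_mx 0 i).
Proof.
move=> cx hi j; rewrite coord_shiftE; have [->|_] := eqVneq j i.
  by rewrite mulr1.
by rewrite mulr0 addr0; exact: cx.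
Qed.

(** Parametrizing the segment by [s] in [0, 1] treats both signs of [t] and t = 0 alike. One-sided
    derivatives at the faces of the cube suffice, as the mean value theorem needs only continuity at
    the end points. *)
Lemma coord_mvt i g dg x (t : R) : has_partial i g dg -> cube x -> 0 <= x 0 i + t <= 1 ->
  exists2 s, 0 <= s <= 1 &
    g (x + t *: delta_mx 0 i) - g x = t * dg (x + (s * t) *: delta_mx 0 i).
Proof.
move=> hp cx ht; have hx := cx i.
pose y (s : R) := x + (s * t) *: delta_mx 0 i.
have cy s : 0 <= s <= 1 -> cube (y s).
  by move=> hs; apply: cube_shift => //; move: hx ht hs; nra.
have yD s h : y (h + s) = y s + (h * t) *: delta_mx 0 i.
  by rewrite /y mulrDl scalerDl addrA addrAC.
pose phi s := g (y s).
have hphi s (e : R) : 0 <= s <= 1 -> 0 < e -> exists2 r : R, 0 < r &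
   forall h, `|h| < r -> 0 <= h + s <= 1 -> `|phi (h + s) - phi s - h * (t * dg (y s))| <= e * `|h|.
  (* Dividing by |t| + 1 rather than |t| keeps the case t = 0. *)
  move=> hs e0; have [r r0 hr] := hp (y s) (cy s hs) (e / (`|t| + 1)) (divr_gt0 e0 (ltr_wpDl (normr_ge0 t) ltr01)).
  have t1 : 0 < `|t| + 1 by rewrite ltr_wpDl.
  exists (r / (`|t| + 1)); first by rewrite divr_gt0.
  move=> h hlt hs'; rewrite /phi mulrA.
  have := hr (h * t); rewrite -yD => /(_ _ (cy _ hs')).
  rewrite normrM => hh; apply: le_trans (hh _) _.
    move: hlt; rewrite ltr_pdivlMr // => hlt; apply: le_lt_trans hlt.
    by rewrite ler_wpM2l // lerDl.
  rewrite mulrCA [X in _ <= X]mulrC ler_wpM2l // mulrAC -mulrA ler_piMr ?(ltW e0) //.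
  by rewrite ler_pdivrMr // mul1r lerDl.
have [||s hs hE] := @MVT R phi (fun s => t * dg (y s)) 0 1 ltr01.
- move=> s; rewrite in_itv /= => /andP[s0 s1].
  have lim : h^-1 *: (phi (h *: 1 + s) - phi s) @[h --> 0^'] --> t * dg (y s).
    apply/cvgrPdist_le => e e0.
    have [|r r0 hr] := hphi s e _ e0; first by rewrite !ltW.
    pose r' := Num.min r (Num.min s (1 - s)).
    have r'0 : 0 < r' by rewrite !lt_min r0 s0 subr_gt0.
    rewrite near_withinE; exists r' => //= h; rewrite /ball_ /= sub0r normrN => hr' h0.
    move: hr'; rewrite !lt_min => /and3P[h1 h2 h3].
    have hs : 0 <= h + s <= 1.
      by move: h2 h3; rewrite !ltr_norml => /andP[? ?] /andP[? ?]; lra.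
    have := hr h h1 hs; rewrite [h *: 1]mulr1 => hh.
    rewrite -(ler_pM2r (_ : 0 < `|h|)) ?normr_gt0 //.
    apply: le_trans hh; rewrite -normrM -normrN le_eqVlt; apply/orP; left; apply/eqP.
    by congr `|_|; rewrite /GRing.scale /=; field.
  apply: DeriveDef; first by apply/cvg_ex; eexists; exact: lim.
  exact: cvg_lim lim.
(* Differentiability at [s], with tolerance 1, bounds the increments of [phi] by [K] |u - s|, which
   gives continuity, also at the end points. *)
- apply/subspace_continuousP => s /=; rewrite in_itv /= => hs.
  apply/cvgrPdist_le => e e0.
  pose K := `|t * dg (y s)| + 1.
  have K0 : 0 < K by rewrite ltr_wpDl.
  have [r r0 hr] := hphi s 1 hs ltr01.
  have r'0 : 0 < Num.min r (e / K) by rewrite lt_min r0 divr_gt0.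
  rewrite near_withinE; exists (Num.min r (e / K)) => //= u; rewrite /ball_ /=.
  rewrite lt_min => /andP[u1 u2]; rewrite in_itv /= => hu.
  have := hr (u - s); rewrite subrK => /(_ _ hu) hh.
  rewrite distrC in u1; have {}hh := hh u1.
  rewrite distrC; apply: (@le_trans _ _ (K * `|u - s|)).
    have -> : phi u - phi s = (phi u - phi s - (u - s) * (t * dg (y s))) + (u - s) * (t * dg (y s)) by ring.
    apply: le_trans (ler_normD _ _) _; rewrite normrM.
    have -> : K * `|u - s| = 1 * `|u - s| + `|u - s| * `|t * dg (y s)| by rewrite /K; ring.
    exact: lerD.
  by rewrite distrC mulrC -ler_pdivlMr // ltW.
exists s; first by move: hs; rewrite in_itv /= => /andP[? ?]; rewrite !ltW.
by move: hE; rewrite /phi /y mul1r mul0r scale0r addr0 subr0 mulr1.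
Qed.

(* Moving from [x0] to [x] one coordinate at a time never leaves the box. *)
Lemma box_mvt g (dg : 'I_m -> 'rV[R]_m -> R) x0 x (rho M : R) :
  (forall i, has_partial i g (dg i)) -> cube x0 -> cube x ->
  (forall j, `|x 0 j - x0 0 j| <= rho) ->
  (forall i z, cube z -> (forall j, `|z 0 j - x0 0 j| <= rho) -> `|dg i z| <= M) ->
  `|g x - g x0| <= m%:R * (M * rho).
Proof.
move=> hp cx0 cx hx hM.
pose y (n : nat) : 'rV[R]_m := \row_j (if (j < n)%N then x 0 j else x0 0 j).
have step n : (n <= m)%N -> `|g (y n) - g x0| <= n%:R * (M * rho).
  elim: n => [_|n IH nm].
    rewrite mul0r (_ : y 0%N = x0) ?subrr ?normr0 //.
    by apply/rowP => j; rewrite mxE.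
  pose i := Ordinal nm; pose t := x 0 i - x0 0 i.
  have yS : y n.+1 = y n + t *: delta_mx 0 i.
    apply/rowP => j; rewrite coord_shiftE !mxE ltnS leq_eqVlt.
    have [->|ji] := eqVneq j i; first by rewrite eqxx ltnn mulr1 /t addrC subrK.
    by rewrite (negbTE (_ : nat_of_ord j != n)) // mulr0 addr0.
  have yi : y n 0 i = x0 0 i by rewrite mxE ltnn.
  have cy : cube (y n) by move=> j; rewrite mxE; case: ifP.
  have rho0 : 0 <= rho by exact: le_trans (hx i).
  have [|s hs hE] := coord_mvt (t := t) (hp i) cy.
    by rewrite yi /t addrC subrK; exact: cx.
  have -> : g (y n.+1) - g x0 = (g (y n) - g x0) + t * dg i (y n + (s * t) *: delta_mx 0 i).
    by rewrite -hE -yS; ring.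
  apply: le_trans (ler_normD _ _) _.
  rewrite -natr1 [X in _ <= X]mulrDl mul1r lerD ?IH 1?ltnW // normrM mulrC.
  have tr : `|t| <= rho by exact: hx.
  have hst : `|s * t| <= rho.
    have /andP[s0 s1] := hs.
    by rewrite normrM ger0_norm // (le_trans _ tr) // ler_piMl.
  have M0 : `|dg i (y n + (s * t) *: delta_mx 0 i)| <= M.
    apply: hM => [|j].
      apply: cube_shift => //; rewrite yi /t.
      have := cx0 i; have := cx i; move: hs; nra.
    rewrite coord_shiftE; have [->|ji] := eqVneq j i.
      by rewrite yi mulr1 addrC addKr.
    by rewrite mulr0 addr0 mxE; case: ifP => _; [exact: hx|rewrite subrr normr0].
  by apply: ler_pM.
have := step m (leqnn m); rewrite (_ : y m = x) //.
by apply/rowP => j; rewrite mxE ltn_ord.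
Qed.

End PartialDerivatives.

(** * Partial derivatives of polynomials *)

Section MpolyPartial.
Variables (R : realType) (m : nat).
Implicit Types (p : mpoly m R) (i : 'I_m).

(** The expansion for n + 1 is (a + h) times the one for [n], leaving the extra term n a^(n-1) h^2.
    A quadratic remainder is stable under linear combinations, hence passes to polynomials. *)
Lemma exprD_quadratic (a : R) (n : nat) : exists2 C : R, 0 <= C &
  forall h, `|h| <= 1 -> `|(a + h) ^+ n - a ^+ n - n%:R * a ^+ n.-1 * h| <= C * h ^+ 2.
Proof.
elim: n => [|n [C C0 IH]].
  by exists 0 => // h _; rewrite !expr0 subrr !mul0r subrr normr0.
exists ((`|a| + 1) * C + `|n%:R * a ^+ n.-1|) => [|h h1].
  by rewrite addr_ge0 ?mulr_ge0 ?addr_ge0.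
have -> : (a + h) ^+ n.+1 - a ^+ n.+1 - n.+1%:R * a ^+ n.+1.-1 * h =
   (a + h) * ((a + h) ^+ n - a ^+ n - n%:R * a ^+ n.-1 * h) + n%:R * a ^+ n.-1 * h ^+ 2.
  rewrite !exprS -natr1 /=; case: n {IH} => [|n]; first by rewrite !expr0; ring.
  by rewrite /= [a ^+ n.+1]exprS; ring.
apply: le_trans (ler_normD _ _) _; rewrite [X in _ <= X]mulrDl.
apply: lerD; rewrite normrM; last by rewrite normrX real_normK ?num_real.
rewrite -[X in _ <= X]mulrA ler_pM //; last exact: IH.
by apply: le_trans (ler_normD _ _) _; rewrite lerD2l.
Qed.

Definition coord_shift (v : 'I_m -> R) i (h : R) j := v j + h * (j == i)%:R.

Lemma meval_quadratic p (v : 'I_m -> R) i : exists2 C : R, 0 <= C &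
  forall h, `|h| <= 1 ->
    `|meval (coord_shift v i h) p - meval v p - h * meval v (mderiv i p)| <= C * h ^+ 2.
Proof.
elim/(@mpolyind m R): p => [|c mu p _ _ [C C0 IH]].
  by exists 0 => // h _; rewrite mderiv0 !meval0 subrr mulr0 subrr normr0 mul0r.
have [C' C'0 hC'] := exprD_quadratic (v i) (mu i).
pose Q := \prod_(j | j != i) v j ^+ mu j.
exists (`|c| * `|Q| * C' + C) => [|h h1].
  by rewrite addr_ge0 ?mulr_ge0.
have Xs : \prod_j coord_shift v i h j ^+ mu j = (v i + h) ^+ mu i * Q.
  rewrite (bigD1 i) //= /coord_shift eqxx mulr1; congr (_ * _).
  by apply: eq_bigr => j ji; rewrite (negbTE ji) mulr0 addr0.
have X0 : \prod_j v j ^+ mu j = v i ^+ mu i * Q by rewrite (bigD1 i).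
(* If [mu i] is 0 the exponent is truncated to 0, harmlessly, as the derivative carries the factor
   [mu i]. *)
have X1 : \prod_j v j ^+ (mnm_sub mu (mnm1 i)) j = v i ^+ (mu i).-1 * Q.
  rewrite (bigD1 i) //= mnmBE mnm1E eqxx subn1; congr (_ * _).
  by apply: eq_bigr => j ji; rewrite mnmBE mnm1E eq_sym (negbTE ji) subn0.
rewrite mderivD mderivZ mderivX !mevalD !mevalZ !mevalX Xs X0 X1.
set A := meval _ p; set B := meval _ p; set D := meval _ (mderiv i p).
have -> : c * ((v i + h) ^+ mu i * Q) + A - (c * (v i ^+ mu i * Q) + B)
   - h * (c * ((mu i)%:R * (v i ^+ (mu i).-1 * Q)) + D) =
  c * Q * ((v i + h) ^+ mu i - v i ^+ mu i - (mu i)%:R * v i ^+ (mu i).-1 * h)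
   + (A - B - h * D) by ring.
apply: le_trans (ler_normD _ _) _; rewrite [X in _ <= X]mulrDl lerD //; last exact: IH.
by rewrite !normrM -[X in _ <= X]mulrA ler_wpM2l ?mulr_ge0 // hC'.
Qed.

Lemma has_partial_meval p i (x0 : 'rV[R]_m) :
  has_partial i (fun x => meval (fun j => (x - x0) 0 j) p)
                (fun x => meval (fun j => (x - x0) 0 j) (mderiv i p)).
Proof.
move=> x _ e e0.
have [C C0 hC] := meval_quadratic p (fun j => (x - x0) 0 j) i.
have C1 : 0 < C + 1 by rewrite ltr_wpDl.
exists (Num.min 1 (e / (C + 1))); first by rewrite lt_min ltr01 divr_gt0.
move=> h; rewrite lt_min => /andP[h1 h2] _.
rewrite (@meval_eq _ _ _ (coord_shift (fun j => (x - x0) 0 j) i h)); last first.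
  by move=> j; rewrite /coord_shift addrAC !mxE eqxx.
apply: le_trans (hC h (ltW h1)) _.
rewrite -real_normK ?num_real // expr2 mulrA ler_wpM2r //.
move: h2; rewrite ltr_pdivlMr // => h2; apply: le_trans (ltW h2).
by rewrite mulrC ler_wpM2l // lerDl.
Qed.

End MpolyPartial.

(** * Taylor polynomials of functions on the cube *)

Section Taylor.
Variables (R : realType) (m s : nat) (nabla : multinom m -> 'rV[R]_m -> R).
Hypothesis nablaP : forall kappa i, (mdeg kappa < s)%N ->
  has_partial i (nabla kappa) (nabla (mnm_add kappa (mnm1 i))).

(** All derivatives of the remainder up to order [s] vanish at [x0], and those of order [s] are
    oscillations of [nabla kappa], bounded by [H]. Each descent by one order costs a factor m rho
    through [box_mvt]. *)
Lemma taylor_box (x0 : 'rV[R]_m) (rho H : R) : cube x0 -> 0 <= rho ->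
  (forall kappa x, mdeg kappa = s -> cube x ->
     (forall j, `|x 0 j - x0 0 j| <= rho) -> `|nabla kappa x - nabla kappa x0| <= H) ->
  exists2 p : mpoly m R, (msize p <= s.+1)%N &
    forall x, cube x -> (forall j, `|x 0 j - x0 0 j| <= rho) ->
      `|nabla (@mnm0 m) x - meval (fun j => (x - x0) 0 j) p| <= m%:R ^+ s * H * rho ^+ s.
Proof.
move=> cx0 rho0 hH.
pose E (mu : multinom m) : R := nabla mu x0 / (multi_factorial mu)%:R.
pose p : mpoly m R := \sum_(mu : bmultinom m s.+1) E mu *: mpolyX R mu.
have psize : (msize p <= s.+1)%N.
  apply: (leq_trans (mmeasure_sum _ _ _ _)); apply/bigmax_leqP => mu _.
  by apply: leq_trans (msizeZ_le _ _) _; rewrite msizeX; exact: bmdeg.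
have pE mu : (mdeg mu <= s)%N -> mcoeff mu p = E mu.
  by move=> mus; rewrite /p mcoeff_mpoly.
have p0 mu : (s < mdeg mu)%N -> mcoeff mu p = 0.
  move=> smu; apply/eqP; rewrite mcoeff_eq0; apply: msize_mdeg_ge.
  exact: leq_trans psize _.
have fact0 (mu : multinom m) : (multi_factorial mu)%:R != 0 :> R.
  by rewrite pnatr_eq0 -lt0n prodn_gt0 // => j; exact: fact_gt0.
have dcoef0 mu : (mdeg mu <= s)%N -> mcoeff (@mnm0 m) (mderivm mu p) = nabla mu x0.
  move=> mus; rewrite mcoeff_mderivm addm0 pE // /E -[LHS]mulr_natr -mulrA.
  rewrite (_ : (\prod_(i < m) _)%N = multi_factorial mu) ?mulVf ?mulr1 //.
  by apply: eq_bigr => j _; rewrite ffactnn.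
have ev0 q : meval (fun j => (x0 - x0) 0 j) q = mcoeff (@mnm0 m) q.
  rewrite -[q in LHS](subrK (mpolyC m (mcoeff (@mnm0 m) q))) mevalD mevalC.
  set q' := q - _; rewrite (_ : meval _ q' = 0) ?add0r //.
  rewrite mevalE big1_seq // => mu /andP[_ muq].
  have [mu0|mu0] := eqVneq mu (@mnm0 m).
    by move: muq; rewrite mcoeff_msupp mu0 /q' mcoeffB mcoeffC eqxx mulr1 subrr eqxx.
  have [j muj] := mnm_neq0 mu0.
  by rewrite (bigD1 j) //= subrr mxE expr0n (negbTE muj) mul0r mulr0.
(* The degree of [p] is at most [s], so its derivatives of order [s] are constants. *)
have dtop mu : mdeg mu = s -> mderivm mu p = mpolyC m (nabla mu x0).
  move=> mus; apply/mpolyP => nu; rewrite mcoeffC.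
  have [->|nu0] := eqVneq nu (@mnm0 m); first by rewrite dcoef0 ?mus // mulr1.
  rewrite mulr0 mcoeff_mderivm p0 ?mul0rn // mdegD mus -[X in (X < _)%N]addn0 ltn_add2l.
  by rewrite lt0n mdeg_eq0.
pose r kappa x := nabla kappa x - meval (fun j => (x - x0) 0 j) (mderivm kappa p).
have rP kappa i : (mdeg kappa < s)%N -> has_partial i (r kappa) (r (mnm_add kappa (mnm1 i))).
  move=> ks; apply: has_partialB; first exact: nablaP.
  by rewrite mderivmDm mderivmU1m; exact: has_partial_meval.
have r0 kappa : (mdeg kappa <= s)%N -> r kappa x0 = 0.
  by move=> ks; rewrite /r ev0 dcoef0 // subrr.
have claim j : (j <= s)%N -> forall kappa x, mdeg kappa = (s - j)%N -> cube x ->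
    (forall j, `|x 0 j - x0 0 j| <= rho) -> `|r kappa x| <= m%:R ^+ j * H * rho ^+ j.
  elim: j => [_ kappa x|j IH js kappa x kE cx hx].
    rewrite subn0 => ks cx hx; rewrite /r dtop // mevalC !expr0 mul1r mulr1.
    exact: hH.
  rewrite -[r kappa x]subr0 -(r0 kappa) ?kE ?leq_subr //.
  have -> : m%:R ^+ j.+1 * H * rho ^+ j.+1 = m%:R * (m%:R ^+ j * H * rho ^+ j * rho) :> R.
    by rewrite !exprS; ring.
  apply: (box_mvt (dg := fun i => r (mnm_add kappa (mnm1 i)))) => //.
    move=> i; apply: rP; rewrite kE ltn_subrL //=; exact: leq_ltn_trans js.
  move=> i z cz hz; apply: IH => //; first exact: ltnW.
  by rewrite mdegD mdeg1 kE addn1 subnSK.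
exists p => // x cx hx; have := claim s (leqnn s) (@mnm0 m) x.
by rewrite /r mderivm0m; apply => //; rewrite mdeg0 subnn.
Qed.

End Taylor.

Section HolderTaylor.
Variables (R : realType) (m : nat) (alpha L : R) (f : 'rV[R]_m -> R).
Hypotheses (m0 : (0 < m)%N) (halpha : 0 < alpha) (hf : holder_class alpha L f).
Let s := holder_order alpha.

Lemma holder_order_bounds : s%:R <= alpha /\ alpha <= s.+1%:R.
Proof.
have c0 : 0 <= Num.ceil (alpha - 1) by rewrite ceil_ge0; move: halpha; lra.
have sE : s%:R = (Num.ceil (alpha - 1))%:~R :> R.
  by rewrite /s /holder_order natr_absz ger0_norm.
have := ceil_itv (alpha - 1); rewrite intrB -sE => /andP[h1 h2].
by rewrite -natr1; split; move: h1 h2; lra.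
Qed.

Lemma sup_norm_le (x y : 'rV[R]_m) (rho : R) : 0 <= rho ->
  (forall j, `|x 0 j - y 0 j| <= rho) -> `|x - y| <= rho.
Proof.
move=> rho0 h; rewrite -[X in X <= _]/(mx_norm (x - y)) mx_normrE; apply/bigmax_leP; split=> // -[i j] _ /=.
by rewrite (ord1 i) !mxE.
Qed.

Lemma cube_dist (x y : 'rV[R]_m) : cube x -> cube y -> forall j, `|x 0 j - y 0 j| <= 1.
Proof.
move=> cx cy j; have := cx j; have := cy j.
by rewrite ler_norml => /andP[? ?] /andP[? ?]; apply/andP; split; lra.
Qed.

Lemma cube0 : cube (0 : 'rV[R]_m).
Proof. by move=> j; rewrite mxE lexx ler01. Qed.

(** If [l >= s], the Hölder condition on the derivatives of order [s] gives the exponent [alpha]; if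
    [l < s], derivatives of order l + 1 exist and are bounded on the cube, which gives the exponent
    l + 1. The constant depends on [f] but is uniform in [l], [x0] and [rho]. *)
Lemma holder_taylor : exists2 C : R, 0 < C &
  forall (l : nat) (x0 : 'rV[R]_m) (rho : R), cube x0 -> 0 < rho -> rho <= 1 ->
  exists2 p : mpoly m R, (msize p <= l.+1)%N &
    forall x, cube x -> (forall j, `|x 0 j - x0 0 j| <= rho) ->
      `|f x - meval (fun j => (x - x0) 0 j) p| <= C * rho `^ (Num.min alpha l.+1%:R).
Proof.
have [nabla [n0 nP nH]] := hf; rewrite -/s in nP nH.
have hP kappa i : (mdeg kappa < s)%N ->
    has_partial i (nabla kappa) (nabla (mnm_add kappa (mnm1 i))).
  by move=> ?; apply: is_partialW; exact: nP.
have [sa as1] := holder_order_bounds.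
(* [K] dominates every factorial, so multiplying by it undoes the weights of the Hölder sum. *)
pose K : R := \sum_(mu : bmultinom m s.+1) (multi_factorial mu)%:R.
have K0 : 0 <= K by apply: sumr_ge0.
have m1 : 1 <= m%:R :> R by rewrite ler1n.
pose H : R := K * `|L|.
have H0 : 0 <= H by rewrite mulr_ge0.
have hH (x0 : 'rV[R]_m) rho kappa x : mdeg kappa = s -> cube x -> cube x0 -> 0 <= rho ->
   (forall j, `|x 0 j - x0 0 j| <= rho) ->
   `|nabla kappa x - nabla kappa x0| <= H * rho `^ (alpha - s%:R).
  move=> ks cx cx0 rho0 hx.
  have ks' : (mdeg kappa < s.+1)%N by rewrite ks.
  pose ka : bmultinom m s.+1 := BMultinom ks'.
  have fp : 0 < (multi_factorial kappa)%:R :> R.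
    by rewrite ltr0n prodn_gt0 // => j; exact: fact_gt0.
  have h1 : (multi_factorial kappa)%:R^-1 * `|nabla kappa x - nabla kappa x0|
      <= `|L| * rho `^ (alpha - s%:R).
    apply: (@le_trans _ _ (L * `|x - x0| `^ (alpha - s%:R))).
      apply: le_trans (nH x x0 cx cx0); rewrite (bigD1 ka) /=; last exact/eqP.
      by rewrite lerDl sumr_ge0.
    apply: (@le_trans _ _ (`|L| * `|x - x0| `^ (alpha - s%:R))).
      by rewrite ler_wpM2r ?powR_ge0 // ler_norm.
    rewrite ler_wpM2l //; apply: ge0_ler_powR; rewrite ?nnegrE ?subr_ge0 //.
    exact: sup_norm_le.
  move: h1; rewrite mulrC ler_pdivrMr // mulrC => /le_trans; apply.
  rewrite /H -mulrA ler_wpM2r ?mulr_ge0 ?powR_ge0 //.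
  by rewrite /K (bigD1 ka) //= lerDl sumr_ge0.
pose Z : R := \sum_(mu : bmultinom m s.+1) `|nabla mu 0|.
have hZ kappa : (mdeg kappa <= s)%N -> `|nabla kappa 0| <= Z.
  rewrite -ltnS => ks; rewrite /Z (bigD1 (BMultinom ks)) //= lerDl sumr_ge0 //.
have [M M0 hM] : exists2 M : R, 0 <= M &
    forall kappa x, (mdeg kappa <= s)%N -> cube x -> `|nabla kappa x| <= M.
  (* Descending induction on the order: order [s] is bounded by its value at 0 and its oscillation
     over the cube, each lower order by its value at 0 and the mean value inequality. *)
  suff claim j : (j <= s)%N -> exists2 M : R, 0 <= M &
      forall kappa x, (s - j <= mdeg kappa)%N -> (mdeg kappa <= s)%N -> cube x -> `|nabla kappa x| <= M.
    have [M M0 hM] := claim s (leqnn s); exists M => // kappa x ks cx.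
    by apply: hM => //; rewrite subnn.
  have Z0 : 0 <= Z by apply: sumr_ge0.
  have tri kappa x : `|nabla kappa x| <= `|nabla kappa 0| + `|nabla kappa x - nabla kappa 0|.
    by rewrite -{1}[nabla kappa x](subrK (nabla kappa 0)) addrC ler_normD.
  elim: j => [_|j IH js].
    exists (Z + H); first by rewrite addr_ge0.
    move=> kappa x; rewrite subn0 => k1 k2 cx; apply: le_trans (tri _ _) _.
    rewrite lerD ?hZ //; have ks : mdeg kappa = s by apply/eqP; rewrite eqn_leq k2.
    have := hH 0 1 kappa x ks cx cube0 ler01 (cube_dist cx cube0).
    by rewrite powR1 mulr1.
  have [M M0 hM] := IH (ltnW js); exists (M + (Z + m%:R * M)).
    by rewrite !addr_ge0 ?mulr_ge0.
  move=> kappa x k1 k2 cx; have [k3|k3] := leqP (s - j) (mdeg kappa).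
    by apply: le_trans (hM _ _ k3 k2 cx) _; rewrite lerDl addr_ge0 ?mulr_ge0.
  apply: le_trans (tri _ _) _; apply: (@le_trans _ _ (Z + m%:R * M)); last by rewrite lerDr.
  rewrite lerD ?hZ // -[M]mulr1.
  apply: (box_mvt (dg := fun i => nabla (mnm_add kappa (mnm1 i)))) => //.
  - by move=> i; apply: hP; apply: leq_trans k3 (leq_subr _ _).
  - exact: cube0.
  - exact: (cube_dist cx cube0).
  - move=> i z cz _; apply: hM => //; rewrite mdegD mdeg1 addn1.
      by rewrite -(subnSK js) ltnS.
    by apply: leq_trans k3 (leq_subr _ _).
(* The summands [H] and [m%:R * M] serve the regimes l >= s and l < s, with m^l <= m^s in the
   latter; the 1 secures positivity. *)
exists (m%:R ^+ s * (H + m%:R * M) + 1).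
  by rewrite ltr_wpDl // mulr_ge0 ?exprn_ge0 ?addr_ge0 ?mulr_ge0.
move=> l x0 rho cx0 rho0 rho1.
have rho0' := ltW rho0.
have [sl|ls] := leqP s l.
  have [p ps hp] := taylor_box hP cx0 rho0' (fun kappa x ks cx hx => hH x0 rho kappa x ks cx cx0 rho0' hx).
  exists p => [|x cx hx]; first exact: leq_trans ps _.
  rewrite -n0 //; apply: le_trans (hp x cx hx) _.
  rewrite (_ : Num.min _ _ = alpha); last first.
    by apply/min_idPl; apply: le_trans as1 _; rewrite ler_nat.
  have -> : m%:R ^+ s * (H * rho `^ (alpha - s%:R)) * rho ^+ s = m%:R ^+ s * H * rho `^ alpha.
    rewrite (_ : rho `^ alpha = rho `^ (alpha - s%:R) * rho ^+ s); first by ring.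
    rewrite -powR_mulrn // -powRD ?subrK //.
    by apply/implyP => _; rewrite gt_eqF.
  rewrite ler_wpM2r ?powR_ge0 //.
  have : 0 <= m%:R ^+ s * (m%:R * M) by rewrite !mulr_ge0 ?exprn_ge0.
  by rewrite mulrDr; lra.
have hP' kappa i : (mdeg kappa < l)%N ->
    has_partial i (nabla kappa) (nabla (mnm_add kappa (mnm1 i))).
  by move=> kl; apply: hP; apply: ltn_trans ls.
have osc kappa x : mdeg kappa = l -> cube x -> (forall j, `|x 0 j - x0 0 j| <= rho) ->
    `|nabla kappa x - nabla kappa x0| <= m%:R * (M * rho).
  move=> kl cx hx.
  apply: (box_mvt (dg := fun i => nabla (mnm_add kappa (mnm1 i)))) => //.
    by move=> i; apply: hP; rewrite kl.
  by move=> i z cz _; apply: hM => //; rewrite mdegD mdeg1 kl addn1.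
have [p ps hp] := taylor_box hP' cx0 rho0' osc.
exists p => // x cx hx.
rewrite -n0 //; apply: le_trans (hp x cx hx) _.
rewrite (_ : Num.min _ _ = l.+1%:R); last first.
  by apply/min_idPr; apply: le_trans sa; rewrite ler_nat.
rewrite powR_mulrn // exprS.
have -> : m%:R ^+ l * (m%:R * (M * rho)) * rho ^+ l = m%:R ^+ l * (m%:R * M) * (rho * rho ^+ l) by ring.
rewrite ler_wpM2r ?mulr_ge0 ?exprn_ge0 //.
apply: (@le_trans _ _ (m%:R ^+ s * (m%:R * M))).
  by rewrite ler_wpM2r ?mulr_ge0 // ler_weXn2l // ltnW.
have : 0 <= m%:R ^+ s * H by rewrite !mulr_ge0 ?exprn_ge0.
by rewrite mulrDr; lra.
Qed.

End HolderTaylor.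

(** * Block-wise polynomial approximation of sampled functions *)

Lemma msize_prod_expr (R : idomainType) (m : nat) (q : 'I_m -> mpoly m R) (mu : multinom m) :
  (forall i, msize (q i) <= 2)%N -> (msize (\prod_i q i ^+ mu i) <= (mdeg mu).+1)%N.
Proof.
move=> q2.
have hM (a b : mpoly m R) u v : (msize a <= u.+1)%N -> (msize b <= v.+1)%N ->
    (msize (a * b) <= (u + v).+1)%N.
  have [->|a0] := eqVneq a 0; first by rewrite mul0r msize0.
  have [->|b0] := eqVneq b 0; first by rewrite mulr0 msize0.
  by move=> au bv; rewrite msizeM // -subn1 leq_subLR add1n -addnS -addSn leq_add.
have hX (a : mpoly m R) n : (msize a <= 2)%N -> (msize (a ^+ n) <= n.+1)%N.
  move=> a2; elim: n => [|n IH]; first by rewrite expr0 msize1.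
  by rewrite exprS -[n.+1]add1n hM.
rewrite mdegE.
elim/big_ind2: _ => [|a u b v au bv|i _]; first by rewrite msize1.
  exact: hM.
exact: hX.
Qed.

(** Taylor polynomials are written in the centred variable x - x0 with x = i/d, while [block_poly]
    asks for polynomials in the integer indices; an affine substitution does not raise the
    degree. *)
Lemma meval_affine (R : idomainType) (m l : nat) (p : mpoly m R) (a : R) (b : 'I_m -> R) :
  (msize p <= l.+1)%N ->
  exists2 q : mpoly m R, (msize q <= l.+1)%N &
    forall v, meval v q = meval (fun j => a * v j - b j) p.
Proof.
move=> pl.
pose lq := [tuple (a *: mpolyX R (mnm1 j) + mpolyC m (- b j) : mpoly m R) | j < m].
have lqE j : tnth lq j = a *: mpolyX R (mnm1 j) + mpolyC m (- b j) by rewrite tnth_mktuple.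
exists (comp_mpoly lq p) => [|v]; last first.
  rewrite comp_mpoly_meval; apply: meval_eq => j /=.
  by rewrite lqE mevalD mevalZ mevalXU mevalC.
rewrite (comp_mpolywE _ pl); apply: (leq_trans (mmeasure_sum _ _ _ _)).
apply/bigmax_leqP => mu _; apply: (leq_trans (msizeZ_le _ _)).
apply: leq_trans (bmdeg mu); apply: msize_prod_expr => i; rewrite lqE.
apply: (leq_trans (mmeasureD_le _ _ _)); rewrite geq_max msizeC.
rewrite (leq_trans (msizeZ_le _ _)) ?msizeX ?mdeg1 //=.
by case: (- b i != 0).
Qed.

(** Rescaled by d, each block lies in a cube of side 1/k whose upper corner is its label divided by
    k; Taylor expansion about this corner with rho = 1/k gives the approximation. *)
Lemma holder_block_approx (R : realType) (m : nat) (alpha L : R) (f : 'rV[R]_m -> R) :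
  (0 < m)%N -> 0 < alpha -> holder_class alpha L f ->
  exists2 C : R, 0 < C & forall d k l : nat, (0 < k)%N -> (k <= d)%N ->
    exists2 B : tensor R m d, block_poly k l B &
      forall i, `|B i - f (\row_j ((i j).+1%:R / d%:R))|
        <= C / k%:R `^ (Num.min alpha l.+1%:R).
Proof.
move=> m0 a0 hf; have [C C0 hC] := holder_taylor m0 a0 hf.
exists C => // d k l k0 kd.
have d0 : (0 < d)%N by exact: leq_trans kd.
have kR : 0 < k%:R :> R by rewrite ltr0n.
have dR : 0 < d%:R :> R by rewrite ltr0n.
(* Capping by [k] keeps the centre in the cube for every [b], also for labels that do not occur;
   actual labels are at most [k]. *)
pose x0 (b : {ffun 'I_m -> nat}) : 'rV[R]_m := \row_j (Num.min (b j)%:R k%:R / k%:R).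
have cx0 b : cube (x0 b).
  move=> j; rewrite mxE divr_ge0 ?le_min ?ler0n //= ler_pdivrMr // mul1r.
  by rewrite ge_min lexx orbT.
have rho1 : k%:R^-1 <= 1 :> R by rewrite invf_le1 // ler1n.
have /choice[p hp] : forall b, exists p : mpoly m R, (msize p <= l.+1)%N /\
    forall x, cube x -> (forall j, `|x 0 j - x0 b 0 j| <= k%:R^-1) ->
      `|f x - meval (fun j => (x - x0 b) 0 j) p| <= C * k%:R^-1 `^ (Num.min alpha l.+1%:R).
  move=> b; have kV0 : 0 < k%:R^-1 :> R by rewrite invr_gt0.
  by have [p ? ?] := hC l (x0 b) k%:R^-1 (cx0 b) kV0 rho1; exists p.
have /choice[q hq] : forall b, exists q : mpoly m R, (msize q <= l.+1)%N /\
    forall v, meval v q = meval (fun j => d%:R^-1 * v j - x0 b 0 j) (p b).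
  by move=> b; have [q ? ?] := meval_affine d%:R^-1 (x0 b 0) (hp b).1; exists q.
exists [ffun i : tensor_index m d => meval (fun j => (i j).+1%:R) (q (block k i))].
  by exists q; split => [b|i]; [case: (hq b)|rewrite ffunE].
move=> i; rewrite ffunE (hq _).2 distrC.
pose x : 'rV[R]_m := \row_j ((i j).+1%:R / d%:R).
have -> : meval (fun j => d%:R^-1 * (i j).+1%:R - x0 (block k i) 0 j) (p (block k i)) =
    meval (fun j => (x - x0 (block k i)) 0 j) (p (block k i)).
  by apply: meval_eq => j /=; rewrite !mxE mulrC.
have -> : (k%:R `^ Num.min alpha l.+1%:R)^-1 = k%:R^-1 `^ Num.min alpha l.+1%:R :> R.
  by rewrite -[in RHS]powR_inv1 // -powRrM mulN1r powRN.
apply: (hp _).2.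
  move=> j; rewrite mxE divr_ge0 //= ler_pdivrMr // mul1r ler_nat.
  exact: ltn_ord.
move=> j; rewrite !mxE ffunE.
(* The label c is the ceiling of k n / d, that is c d - d < k n <= c d; these are [h1] and [h2]. *)
set c := block_label k (i j); set n := (i j).+1.
have /andP[c1 c2] : (c * d <= k * n + d.-1 < c.+1 * d)%N.
  by rewrite leq_divM -ltn_divLR // ltnSn.
have kn : (k * n <= k * d)%N by rewrite leq_mul2l ltn_ord orbT.
have h1 : (c * d < k * n + d)%N.
  by apply: leq_ltn_trans c1 _; rewrite ltn_add2l prednK.
have h2 : (k * n <= c * d)%N.
  have e : (d.-1 + (c * d).+1 = c.+1 * d)%N by rewrite addnS -addSn prednK.
  by rewrite -ltnS -(ltn_add2l d.-1) e addnC.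
have ck : (c <= k)%N.
  rewrite -ltnS -(ltn_pmul2r d0); apply: leq_trans h1 _.
  by rewrite mulSn addnC leq_add2l.
rewrite (_ : Num.min _ _ = c%:R); last by apply/min_idPl; rewrite ler_nat.
have -> : n%:R / d%:R - c%:R / k%:R = (k%:R * n%:R - c%:R * d%:R) / d%:R * k%:R^-1 :> R.
  by field; rewrite !gt_eqF.
rewrite normrM [X in _ * X]gtr0_norm ?invr_gt0 // ler_piMl ?invr_ge0 //.
rewrite normrM normfV (gtr0_norm dR) ler_pdivrMr // mul1r -!natrM.
move: h1 h2; rewrite -(ltr_nat R) -(ler_nat R) natrD ler_norml.
by move=> h1 h2; apply/andP; split; lra.
Qed.

(** * Risk of the least squares estimator *)

(** With D = F - Fs and g = theta - Fs, minimality reads |D|^2 <= 2 <D, g> + 2 <D, E>. Both cross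
    terms are absorbed in |D|^2 up to multiples of |g|^2 and [t]. *)
Lemma lse_error (R : realType) (I : finType) (theta E F Fs : I -> R) (t : R) :
  0 <= t ->
  \sum_i (theta i + E i - F i) ^+ 2 <= \sum_i (theta i + E i - Fs i) ^+ 2 ->
  dot (fun i => F i - Fs i) E ^+ 2
    <= t * dot (fun i => F i - Fs i) (fun i => F i - Fs i) ->
  \sum_i (F i - theta i) ^+ 2 <= 18 * \sum_i (Fs i - theta i) ^+ 2 + 16 * t.
Proof.
move=> t0 hle hE.
pose D i := F i - Fs i; pose g i := theta i - Fs i.
have h1 : \sum_i (theta i + E i - F i) ^+ 2 =
    \sum_i (theta i + E i - Fs i) ^+ 2 + dot D D - 2 * dot D g - 2 * dot D E.
  rewrite /dot !mulr_sumr -big_split /= -!sumrB; apply: eq_bigr => i _.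
  by rewrite /D /g; ring.
have h2 : \sum_i (F i - theta i) ^+ 2 = dot D D - 2 * dot D g + dot g g.
  rewrite /dot !mulr_sumr -sumrB -big_split /=; apply: eq_bigr => i _.
  by rewrite /D /g; ring.
have h3 : \sum_i (Fs i - theta i) ^+ 2 = dot g g.
  by apply: eq_bigr => i _; rewrite /g; ring.
have hg : dot D g ^+ 2 <= dot D D * dot g g by exact: cauchy_schwarz.
have D0 : 0 <= dot D D by exact: dot_ge0.
have g0 : 0 <= dot g g by exact: dot_ge0.
rewrite h2 h3; rewrite h1 -/D in hle hE.
move: (dot D D) (dot D g) (dot g g) (dot D E) hle hE hg D0 g0 => x y z u hle hE hg x0 z0.
(* The weight 1/8 makes the two doubled cross terms use up only half of |D|^2, so that |D|^2 <= 8
   |g|^2 + 8 t. *)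
have amgm (a b : R) : 0 <= b -> a ^+ 2 <= x * b -> `|a| <= x / 8 + 2 * b.
  move=> b0 hab; rewrite -(@ler_pXn2r _ 2) ?nnegrE ?normr_ge0 ?addr_ge0 ?mulr_ge0 ?divr_ge0//.
  rewrite real_normK ?num_real //; apply: le_trans hab _.
  by have := sqr_ge0 (x / 8 - 2 * b); nra.
have := amgm _ _ z0 hg; rewrite ler_norml => /andP[y1 y2].
have : u ^+ 2 <= x * t by rewrite mulrC.
move/(amgm _ _ t0); rewrite ler_norml => /andP[u1 u2].
lra.
Qed.

(** The complement of [G] is the measurable event required inside [A d]; for d = 0 the empty set
    does, as only the limit matters. *)
Lemma whp_of_tail (R : realType) (disp : nat -> measure_display)
    (T : forall d, measurableType (disp d)) (P : forall d, probability (T d) R)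
    (A : forall d, set (T d)) :
  (forall d, (0 < d)%N -> exists G : set (T d), [/\ measurable G,
     (P d G <= (d%:R^-1)%:E)%E & forall w, ~ G w -> A d w]) ->
  with_high_probability P A.
Proof.
move=> h.
have hB0 : forall d, exists B : set (T d), [/\ measurable B,
   B `<=` A d & ((1 - d%:R^-1)%:E <= P d B)%E \/ d = 0%N].
  case=> [|d]; first by exists set0; split => //; right.
  have [G [mG PG GA]] := h d.+1 isT; exists (~` G); split => //.
  - exact: measurableC.
  - by left; rewrite probability_setC // EFinB leeB.
pose B d := projT1 (cid (hB0 d)).
have hB d : [/\ measurable (B d),
   B d `<=` A d & ((1 - d%:R^-1)%:E <= P d (B d))%E \/ d = 0%N] := projT2 (cid (hB0 d)).
exists B; split=> [d|d|]; try by case: (hB d).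
apply: (@squeeze_cvge _ _ _ _ (fun d : nat => (1 - d%:R^-1)%:E) _ (fun=> 1%E)).
- near=> d; have [mB _ PB] := hB d; rewrite probability_le1 // andbT.
  case: PB => // d0; exfalso; have : (0 < d)%N by near: d; exists 1%N.
  by rewrite d0.
- apply: cvg_EFin; first exact: nearW.
  rewrite -[X in _ --> X]subr0; apply: cvgB; first exact: cvg_cst.
  have : (fun d : nat => d.+1%:R^-1 : R) @ \oo --> (0 : R) by exact: cvg_harmonic.
  by rewrite -(cvg_shiftS (fun d : nat => d%:R^-1 : R)).
- exact: cvg_cst.
Unshelve. all: by end_near.
Qed.

(** The deterministic half of the risk bound, for one outcome: the competitor is [B] with the true
    permutation [pi], and its squared distance to the truth is at most d^m eps^2. *)
Lemma lse_mse_bound (R : realType) (m d k l : nat) (theta Fhat B : tensor R m d)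
    (E : tensor_index m d -> R) (pi rho : 'S_d) (eps t : R) :
  (0 < d)%N -> 0 <= t ->
  is_lse k l [ffun i => tensor_perm theta pi i + E i] Fhat rho ->
  block_poly k l B -> (forall i, `|B i - theta i| <= eps) ->
  dot (tensor_perm Fhat rho - tensor_perm B pi) E ^+ 2 <=
    t * dot (tensor_perm Fhat rho - tensor_perm B pi)
            (tensor_perm Fhat rho - tensor_perm B pi) ->
  MSE (tensor_perm Fhat rho) (tensor_perm theta pi)
    <= 18 * eps ^+ 2 + 16 * t / d%:R ^+ m.
Proof.
move=> d0 t0 [hF hmin] hB hBt hE.
have frob2 (U : tensor R m d) : frobenius U ^+ 2 = \sum_i U i ^+ 2.
  by rewrite /frobenius sqr_sqrtr // sumr_ge0 // => i _; exact: sqr_ge0.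
have frob0 (U : tensor R m d) : 0 <= frobenius U by exact: sqrtr_ge0.
have dm0 : 0 < d%:R ^+ m :> R by rewrite exprn_gt0 // ltr0n.
have := hmin B pi hB.
rewrite -(@ler_pXn2r _ 2) ?nnegrE // !frob2 => hle.
rewrite /MSE frob2 mulrC ler_pdivrMr // mulrDl divfK ?gt_eqF //.
pose th (i : tensor_index m d) := theta [ffun j => pi (i j)].
pose F (i : tensor_index m d) := Fhat [ffun j => rho (i j)].
pose Fs (i : tensor_index m d) := B [ffun j => pi (i j)].
have -> : \sum_i (tensor_perm Fhat rho - tensor_perm theta pi) i ^+ 2 =
    \sum_i (F i - th i) ^+ 2.
  by apply: eq_bigr => i _; rewrite !ffunE.
have DE : (tensor_perm Fhat rho - tensor_perm B pi : tensor_index m d -> R)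
    = fun i => F i - Fs i.
  by apply/funext => i; rewrite !ffunE.
apply: (@le_trans _ _ (18 * \sum_i (Fs i - th i) ^+ 2 + 16 * t)).
  apply: (@lse_error _ _ th E) => //; last by rewrite -DE.
  apply: le_trans (le_trans _ hle) _; rewrite le_eqVlt; apply/orP; left; apply/eqP;
    by apply: eq_bigr => i _; rewrite !ffunE.
rewrite lerD2r -mulrA ler_pM2l //.
apply: (@le_trans _ _ (\sum_(i : tensor_index m d) eps ^+ 2)).
  apply: ler_sum => i _; rewrite -real_normK ?num_real //; apply: lerXn2r.
  - by rewrite nnegrE.
  - by rewrite nnegrE (le_trans _ (hBt [ffun j => pi (i j)])).
  - exact: hBt.
by rewrite sumr_const card_ffun !card_ord -[X in X <= _]mulr_natr natrX.
Qed.

Section Risk.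
Variables (R : realType) (m : nat) (alpha L : R).
Hypotheses (hm : (2 <= m)%N) (halpha : 0 < alpha) (hL : 0 < L).

Lemma natrX_expR (d : nat) : (0 < d)%N -> d%:R ^+ d = expR (d%:R * ln d%:R) :> R.
Proof. by move=> d0; rewrite expRM_natl lnK // posrE ltr0n. Qed.

Lemma lse_risk (Theta : forall d, tensor R m d) : smooth_tensors alpha L Theta ->
   exists2 c : R, 0 < c &
   forall (l : nat) (k : nat -> nat)
     (disp : nat -> measure_display) (T : forall d, measurableType (disp d))
     (P : forall d, probability (T d) R)
     (E : forall d, tensor_index m d -> {RV (P d) >-> R})
     (pi : forall d, 'S_d)
     (Theta_hat : forall d, T d -> tensor R m d)
     (pi_hat : forall d, T d -> 'S_d),
   (forall d, (0 < d)%N -> (0 < k d <= d)%N) ->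
   (forall d, (0 < d)%N -> sub_gaussian_noise (E d)) ->
   (forall d, (0 < d)%N -> forall w,
      is_lse (k d) l (observation (Theta d) (pi d) (E d) w)
        (Theta_hat d w) (pi_hat d w)) ->
   with_high_probability P (fun d => [set w |
      MSE (tensor_perm (Theta_hat d w) (pi_hat d w))
          (tensor_perm (Theta d) (pi d))
        <= c * lse_rate m alpha L d (k d) l]).
Proof.
move=> [f hf Tf].
have m0 : (0 < m)%N by exact: leq_trans hm.
have [C C0 hC] := holder_block_approx m0 halpha hf.
(* The bias gives 18 (C / L)^2, while 416 = 16 * 26 and 128 = 16 * 8 come from the two parts of [t]
   below. *)
exists (18 * (C / L) ^+ 2 + 416 * 2 ^+ m + 128).
  by rewrite !addr_gt0 // mulr_gt0 // exprn_gt0 // divr_gt0.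
move=> l k disp T P E pi Th ph hk hE hlse.
apply: whp_of_tail => d d0.
have /andP[k0 kd] := hk d d0.
have [B hB hBt] := hC d (k d) l k0 kd.
pose N : R := (2 ^ m * (k d ^ m * (l + m) ^ l))%:R.
have N0 : 0 < N.
  by rewrite ltr0n !muln_gt0 !expn_gt0 /= k0 addn_gt0 m0 orbT.
have ln0 : 0 <= ln d%:R :> R by rewrite ln_ge0 // ler1n.
have dR0 : 0 < d%:R :> R by rewrite ltr0n.
(* One quarter of [t] is 13/2 N + 2 d ln d: the first part cancels the dimension, the second pays
   for d^d and leaves exp (- d ln d) <= 1/d. *)
pose t := 26 * N + 8 * (d%:R * ln d%:R).
have t0 : 0 < t by rewrite ltr_wpDr // ?mulr_ge0 ?mulr_gt0 // ltW.
have [G [mG PG hG]] := sub_gaussian_block_tail l m0 d0 k0 (hE d d0) (pi d) t0.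
exists G; split => //.
  apply: le_trans PG _; rewrite lee_fin natrX_expR // -/N -expRD.
  rewrite -[d%:R^-1](@lnK _) ?posrE ?invr_gt0 // ler_expR lnV ?posrE //.
  have : 1 * ln d%:R <= d%:R * ln d%:R :> R by rewrite ler_wpM2r // ler1n.
  rewrite /t; lra.
move=> w nG /=.
apply: le_trans (@lse_mse_bound _ _ _ _ _ (Theta d) _ B (fun i => E d i w) (pi d) _
  (C / (k d)%:R `^ (Num.min alpha l.+1%:R)) t d0 (ltW t0) (hlse d d0 w) hB _ _) _.
- by move=> i; rewrite Tf; exact: hBt.
- by apply: hG => //; case: (hlse d d0 w).
rewrite /lse_rate.
have -> : (C / (k d)%:R `^ Num.min alpha l.+1%:R) ^+ 2 =
    (C / L) ^+ 2 * (L ^+ 2 / (k d)%:R `^ (2 * Num.min alpha l.+1%:R)).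
  rewrite mulrC [2 * _]mulrC powRrM powR_mulrn ?powR_ge0 //.
  have kp : (k d)%:R `^ Num.min alpha l.+1%:R != 0 :> R.
    by rewrite gt_eqF // powR_gt0 // ltr0n.
  by field; rewrite kp gt_eqF.
have -> : 16 * t / d%:R ^+ m = 416 * 2 ^+ m * ((k d)%:R ^+ m * (l + m)%:R ^+ l / d%:R ^+ m)
    + 128 * (ln d%:R / d%:R ^+ m.-1).
  rewrite /t /N !natrM !natrX; case: (m) m0 => // m' _ /=.
  by rewrite [d%:R ^+ m'.+1]exprS; field; rewrite expf_neq0 ?gt_eqF.
set x := L ^+ 2 / _; set y := _ / d%:R ^+ m; set z := ln _ / _.
have x0 : 0 <= x by rewrite divr_ge0 ?sqr_ge0 ?powR_ge0.
have y0 : 0 <= y by rewrite divr_ge0 ?mulr_ge0 ?exprn_ge0.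
have z0 : 0 <= z by rewrite divr_ge0 ?exprn_ge0.
have a0 : 0 <= (C / L) ^+ 2 by exact: sqr_ge0.
have b0 : 0 <= 2 ^+ m :> R by exact: exprn_ge0.
move: (_ ^+ 2) (2 ^+ m) a0 b0 => a b a0 b0.
have := mulr_ge0 a0 y0; have := mulr_ge0 a0 z0; have := mulr_ge0 b0 x0; have := mulr_ge0 b0 z0.
lra.
Qed.
End Risk.

(** * Optimal degree and number of blocks *)

Section OptimalRate.
Variables (R : realType) (m : nat) (alpha L : R).
Hypotheses (hm : (2 <= m)%N) (halpha : 0 < alpha).
Let q : nat := ((m - 2) * m.+1) %/ 2.
Let l : nat := opt_degree m alpha.
Let a : R := Num.min alpha l.+1%:R.
Let beta : R := 2 * m%:R * a / (m%:R + 2 * a).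
Let k (d : nat) : nat := opt_blocks m alpha 1 d.

Let a0 : 0 < a.
Proof. by rewrite lt_min halpha ltr0n. Qed.

Let mR : 2 <= m%:R :> R.
Proof. by rewrite ler_nat. Qed.

(** The product (m - 2)(m + 1) is even, so the integer division is exact and q + 1 is the threshold
    for [alpha]. *)
Lemma degree_cap : q.+1%:R = m%:R * (m%:R - 1) / 2 :> R.
Proof.
have [n mE] : exists n, m = n.+2 by exists (m - 2)%N; rewrite -addn2 subnK.
rewrite /q mE !subSS subn0.
have h : (2 %| n * n.+3)%N by rewrite dvdn2 oddM /=; case: (odd n).
have := congr1 (fun x => x%:R : R) (divnK h); rewrite /= !natrM => hq.
rewrite -natr1 -[in RHS]addn2 natrD; apply: (mulIf (_ : 2 != 0 :> R)) => //.
by rewrite mulrDl hq -[n.+3]addn3 natrD; field.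
Qed.

(** Below the threshold the cap is inactive: the degree is the Hölder order, whose successor is at
    least [alpha]. *)
Lemma opt_exponent_small : alpha < m%:R * (m%:R - 1) / 2 -> a = alpha.
Proof.
rewrite -degree_cap => h; have [h1 h2] := holder_order_bounds halpha.
have sq : (holder_order alpha <= q)%N by rewrite -ltnS -(ltr_nat R); exact: le_lt_trans h.
by apply/min_idPl; rewrite /l /opt_degree -/q (minn_idPl sq).
Qed.

Lemma opt_exponent_large : m%:R * (m%:R - 1) / 2 <= alpha -> a = m%:R * (m%:R - 1) / 2.
Proof.
rewrite -degree_cap => h; have [h1 h2] := holder_order_bounds halpha.
have sq : (q <= holder_order alpha)%N by rewrite -ltnS -(ler_nat R); exact: le_trans h2.
by rewrite /a /l /opt_degree -/q (minn_idPr sq); apply/min_idPr.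
Qed.

Lemma opt_blocks_bounds d : (0 < d)%N ->
  [/\ (0 < k d)%N, (k d <= d)%N, d%:R `^ (m%:R / (m%:R + 2 * a)) <= (k d)%:R
    & (k d)%:R <= 2 * d%:R `^ (m%:R / (m%:R + 2 * a)) :> R].
Proof.
move=> d0; have d1 : 1 <= d%:R :> R by rewrite ler1n.
have den : 0 < m%:R + 2 * a by move: a0 mR; lra.
pose x : R := d%:R `^ (m%:R / (m%:R + 2 * a)).
(* With 1 <= x <= d, the ceiling of [x] is below x + 1 <= 2 x, and at most the integer d. *)
have x1 : 1 <= x.
  by rewrite -(powRr0 d%:R) ler_powR // divr_ge0 // ltW.
have xd : x <= d%:R.
  rewrite -[X in _ <= X]powRr1 ?ler0n // ler_powR // ler_pdivrMr // mul1r.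
  by rewrite lerDl mulr_ge0 // ltW.
have c0 : 0 <= Num.ceil x by rewrite ceil_ge0; move: x1; lra.
have kE : (k d)%:R = (Num.ceil x)%:~R :> R.
  by rewrite /k /opt_blocks mul1r natr_absz ger0_norm.
have := ceil_itv x; rewrite intrB -kE => /andP[h1 h2].
split.
- by rewrite -(ltr_nat R); move: x1 h2; lra.
- by rewrite -(ler_nat R) kE -[d%:R]/(d%:Z%:~R) ler_int ceil_le_int.
- exact: h2.
- by rewrite -/x; move: x1 h1; lra.
Qed.

(** For x = d^(m / (m + 2 a)) the bias x^(-2 a) and the variance x^m / d^m both equal d^(- beta);
    this balance explains the choice of [k]. Rounding up costs the factor 2^m. *)
Lemma opt_rate_bound d : (0 < d)%N ->
  lse_rate m alpha L d (k d) l <=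
  (L ^+ 2 + 2 ^+ m * (l + m)%:R ^+ l) * d%:R `^ (- beta) + ln d%:R / d%:R ^+ m.-1.
Proof.
move=> d0; have [k0 kd kl ku] := opt_blocks_bounds d0.
have d1 : 1 <= d%:R :> R by rewrite ler1n.
have den : 0 < m%:R + 2 * a by move: a0 mR; lra.
have dn0 : d%:R != 0 :> R by rewrite pnatr_eq0 -lt0n.
have dp e : 0 < d%:R `^ e :> R by rewrite powR_gt0 // ltr0n.
rewrite /lse_rate -/l -/a lerD2r [X in _ <= X]mulrDl; apply: lerD.
  rewrite ler_wpM2l ?sqr_ge0 // powRN lef_pV2 ?posrE ?powR_gt0 ?ltr0n //.
  have -> : beta = m%:R / (m%:R + 2 * a) * (2 * a) by rewrite /beta; field; rewrite gt_eqF.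
  rewrite powRrM; apply: ge0_ler_powR; rewrite ?nnegrE ?powR_ge0 ?ler0n //.
  by rewrite mulr_ge0 // ltW.
apply: (@le_trans _ _ ((2 * d%:R `^ (m%:R / (m%:R + 2 * a))) ^+ m * (l + m)%:R ^+ l / d%:R ^+ m)).
  rewrite ler_wpM2r ?invr_ge0 ?exprn_ge0 // ler_wpM2r ?exprn_ge0 //.
  by apply: lerXn2r; rewrite ?nnegrE ?mulr_ge0 ?powR_ge0.
rewrite exprMn -[_ `^ _ ^+ m]powR_mulrn ?powR_ge0 // -powRrM.
rewrite -[d%:R ^+ m]powR_mulrn // -powRN.
have -> : - beta = m%:R / (m%:R + 2 * a) * m%:R + (- m%:R).
  by rewrite /beta; field; rewrite gt_eqF.
rewrite powRD; last by rewrite dn0 implybT.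
rewrite le_eqVlt; apply/orP; left; apply/eqP; ring.
Qed.

(** The condition on [alpha] is equivalent to beta < m - 1, so the logarithmic term decays faster
    than d^(- beta) and is absorbed. *)
Lemma opt_rate_small : alpha < m%:R * (m%:R - 1) / 2 -> exists2 c2 : R, 0 < c2 &
  forall d, (0 < d)%N ->
    lse_rate m alpha L d (k d) l <= c2 * d%:R `^ (- (2 * m%:R * alpha / (m%:R + 2 * alpha))).
Proof.
move=> h; have aE := opt_exponent_small h.
have den : 0 < m%:R + 2 * alpha by move: halpha mR; lra.
have bE : 2 * m%:R * alpha / (m%:R + 2 * alpha) = beta by rewrite /beta aE.
pose del := m%:R - 1 - beta.
have del0 : 0 < del.
  rewrite /del subr_gt0 -bE ltr_pdivrMr //; move: h mR halpha; nra.
exists (L ^+ 2 + 2 ^+ m * (l + m)%:R ^+ l + del^-1).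
  by rewrite ltr_wpDl ?invr_gt0 // addr_ge0 ?sqr_ge0 // mulr_ge0 ?exprn_ge0.
move=> d d0; rewrite bE; apply: le_trans (opt_rate_bound d0) _.
have d1 : 1 <= d%:R :> R by rewrite ler1n.
have dn0 : d%:R != 0 :> R by rewrite pnatr_eq0 -lt0n.
rewrite [X in _ <= X]mulrDl lerD2l.
(* This is ln x <= x - 1 at x = d^del, where ln x = del ln d. *)
have lnd : ln d%:R <= del^-1 * d%:R `^ del.
  rewrite mulrC ler_pdivlMr // mulrC -ln_powR.
  have := @le_ln1Dx R (d%:R `^ del - 1); rewrite [1 + _]addrC subrK => hl.
  apply: le_trans (hl _) _; last by rewrite gerBl.
  by rewrite ltrBrDl subrr powR_gt0 // ltr0n.
rewrite ler_pdivrMr ?exprn_gt0 ?ltr0n //; apply: le_trans lnd _.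
rewrite -mulrA ler_wpM2l ?invr_ge0 ?(ltW del0) //.
rewrite -powR_mulrn // -powRD; last by rewrite dn0 implybT.
rewrite le_eqVlt; apply/orP; left; apply/eqP; congr (_ `^ _).
have -> : m.-1%:R = m%:R - 1 :> R by rewrite -subn1 natrB // ltnW.
by rewrite /del; ring.
Qed.

(** At a = m (m - 1) / 2 one has m + 2 a = m^2, hence beta = m - 1 exactly; the lower bound [expR 1]
    on d gives ln d >= 1, and the power term is absorbed in the logarithmic one. *)
Lemma opt_rate_large : m%:R * (m%:R - 1) / 2 <= alpha -> exists2 c3 : R, 0 < c3 &
  forall d, expR 1 <= d%:R :> R ->
    lse_rate m alpha L d (k d) l <= c3 * d%:R `^ (- (m%:R - 1)) * ln d%:R.
Proof.
move=> h; have aE := opt_exponent_large h.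
have bE : beta = m%:R - 1.
  rewrite /beta aE; have m0 : m%:R != 0 :> R by rewrite gt_eqF //; move: mR; lra.
  by field; rewrite -[m%:R + _]/(m%:R + _) (_ : _ + _ = m%:R ^+ 2) ?expf_neq0 //; ring.
exists (L ^+ 2 + 2 ^+ m * (l + m)%:R ^+ l + 1).
  by rewrite ltr_wpDl // addr_ge0 ?sqr_ge0 // mulr_ge0 ?exprn_ge0.
move=> d de.
have dR : 0 < d%:R :> R by apply: lt_le_trans de; exact: expR_gt0.
have d0 : (0 < d)%N by rewrite -(ltr_nat R).
have ln1 : 1 <= ln d%:R :> R by rewrite -[X in X <= _](@expRK R) ler_ln ?posrE ?expR_gt0.
apply: le_trans (opt_rate_bound d0) _.
rewrite bE (_ : ln d%:R / d%:R ^+ m.-1 = d%:R `^ (- (m%:R - 1)) * ln d%:R); last first.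
  rewrite mulrC powRN -powR_mulrn //; congr (_^-1 * _); congr (_ `^ _).
  by rewrite -subn1 natrB // ltnW.
rewrite -mulrA [X in _ <= X]mulrDl mul1r lerD2r.
by rewrite ler_wpM2l ?ler_peMr ?powR_ge0 // addr_ge0 ?sqr_ge0 // mulr_ge0 ?exprn_ge0.
Qed.

End OptimalRate.

Theorem theorem1 (R : realType) (m : nat) (alpha L : R)
    (hm : (2 <= m)%N) (halpha : 0 < alpha) (hL : 0 < L) :
  (forall Theta : forall d, tensor R m d, smooth_tensors alpha L Theta ->
   exists2 c : R, 0 < c &
   forall (l : nat) (k : nat -> nat)
     (disp : nat -> measure_display) (T : forall d, measurableType (disp d))
     (P : forall d, probability (T d) R)
     (E : forall d, tensor_index m d -> {RV (P d) >-> R})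
     (pi : forall d, 'S_d)
     (Theta_hat : forall d, T d -> tensor R m d)
     (pi_hat : forall d, T d -> 'S_d),
   (forall d, (0 < d)%N -> (0 < k d <= d)%N) ->
   (forall d, (0 < d)%N -> sub_gaussian_noise (E d)) ->
   (forall d, (0 < d)%N -> forall w,
      is_lse (k d) l (observation (Theta d) (pi d) (E d) w)
        (Theta_hat d w) (pi_hat d w)) ->
   with_high_probability P (fun d => [set w |
      MSE (tensor_perm (Theta_hat d w) (pi_hat d w))
          (tensor_perm (Theta d) (pi d))
        <= c * lse_rate m alpha L d (k d) l]))
  /\
  (exists c1 c2 c3 : R,
   [/\ 0 < c1, 0 < c2 & 0 < c3] /\
   [/\ \forall d \near \oo, (0 < opt_blocks m alpha c1 d <= d)%N,
       alpha < m%:R * (m%:R - 1) / 2 ->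
         \forall d \near \oo,
           lse_rate m alpha L d (opt_blocks m alpha c1 d) (opt_degree m alpha)
             <= c2 * d%:R `^ (- (2 * m%:R * alpha / (m%:R + 2 * alpha)))
     & m%:R * (m%:R - 1) / 2 <= alpha ->
         \forall d \near \oo,
           lse_rate m alpha L d (opt_blocks m alpha c1 d) (opt_degree m alpha)
             <= c3 * d%:R `^ (- (m%:R - 1)) * ln d%:R]).
Proof.
split; first by move=> Theta; exact: lse_risk.
have [c2 c20 hc2] : exists2 c2 : R, 0 < c2 & alpha < m%:R * (m%:R - 1) / 2 ->
    forall d, (0 < d)%N -> lse_rate m alpha L d (opt_blocks m alpha 1 d) (opt_degree m alpha)
      <= c2 * d%:R `^ (- (2 * m%:R * alpha / (m%:R + 2 * alpha))).
  (* In the other regime the claim is vacuous and 1 is a placeholder. *)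
  have [h|h] := boolP (alpha < m%:R * (m%:R - 1) / 2); last by exists 1.
  by have [c2 c20 hc2] := opt_rate_small L hm halpha h; exists c2.
have [c3 c30 hc3] : exists2 c3 : R, 0 < c3 & m%:R * (m%:R - 1) / 2 <= alpha ->
    forall d, expR 1 <= d%:R :> R ->
      lse_rate m alpha L d (opt_blocks m alpha 1 d) (opt_degree m alpha)
      <= c3 * d%:R `^ (- (m%:R - 1)) * ln d%:R.
  have [h|h] := boolP (m%:R * (m%:R - 1) / 2 <= alpha); last by exists 1.
  by have [c3 c30 hc3] := opt_rate_large L hm halpha h; exists c3.
exists 1, c2, c3; split; first by [].
split.
- exists 1%N => // d /= d1.
  by have [-> -> _ _] := opt_blocks_bounds hm halpha d1.
- by move=> h; exists 1%N => // d /= d1; exact: hc2.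
- move=> h; exists (Num.truncn (expR 1 : R)).+1 => // d /= hd; apply: hc3 => //.
  by apply: le_trans (ltW (truncnS_gt _)) _; rewrite ler_nat.
Qed.
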